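(* Let $d\ge 1$ and $t\ge 1$ be integers, let $C_1,\ldots,C_t$ be conjugacy classes of the symmetric group $\mathfrak{S}_d$, and let $m\ge 0$ be an integer. Let $\xi_{d,m}(C_1,\ldots,C_t)$ denote the number of tuples $(\sigma_1,\ldots,\sigma_t)$ with $\sigma_i\in C_i$ for all $i$ such that the product $\sigma_1\sigma_2\cdots\sigma_t$ has exactly $m$ cycles. Then $$\xi_{d,m}(C_1,\ldots,C_t)=\sum_{k\ge 0}(-1)^k\left[{m+k\atop m}\right] W_{d,m+k}(C_1,\ldots,C_t),$$ where for every integer $r\ge 0$ $$W_{d,r}(C_1,\ldots,C_t)=\frac{\prod_{i=1}^t|C_i|}{r!}\sum_{\lambda\vdash d}\mathfrak{c}_{\lambda,r}\,\{\dim(\lambda)\}^{-t+1}\prod_{i=1}^t\chi^{\lambda}(C_i).$$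
   Context: Permutations are multiplied by functional composition; cycles of a permutation include fixed points. For a partition $\lambda\vdash d$, $\chi^\lambda$ is the irreducible character of $\mathfrak{S}_d$ indexed by $\lambda$, $\chi^\lambda(C)$ its value on the class $C$, and $\dim(\lambda)=\chi^\lambda(\mathrm{id})$. For a cell $u=(i,j)$ (row $i$, column $j$) of the Young diagram of $\lambda$, the content is $c(u)=j-i$ and $h(u)$ is the hook length of $u$. For an integer (or indeterminate) $r$, $\mathfrak{m}_{\lambda,r}=\prod_{u\in\lambda}\frac{r+c(u)}{h(u)}$, and for integers $r\ge 0$, $\mathfrak{c}_{\lambda,r}=\sum_{j=0}^{r}(-1)^j\binom{r}{j}\mathfrak{m}_{\lambda,r-j}$. The symbol $\left[{a\atop b}\right]$ denotes the unsigned Stirling number of the first kind (the number of permutations of $a$ elements with exactly $b$ cycles), characterized by $\sum_{b}(-1)^{a-b}\left[{a\atop b}\right]x^b=x(x-1)\cdots(x-a+1)$; it is $0$ when $a<b$. *)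

(* Defs.v *)
From mathcomp Require Import all_boot all_order all_algebra all_fingroup.
Set Implicit Arguments. Unset Strict Implicit. Unset Printing Implicit Defensive.
Import Order.TTheory GRing.Theory Num.Theory.

Definition ncycles (T : finType) (s : {perm T}) : nat := #|porbits s|.

Definition stirling1 (a b : nat) : nat :=
  #|[set s : {perm 'I_a} | ncycles s == b]|.

(* Product sigma_0 o sigma_1 o ... o sigma_(t-1) under FUNCTIONAL composition.
   MathComp's group product satisfies (s * u) x = u (s x), hence the reversal. *)
Definition compprod (d t : nat) (sg : {ffun 'I_t -> {perm 'I_d}}) : {perm 'I_d} :=
  (\prod_(i < t) sg (rev_ord i))%g.

(* Partitions of d: weakly decreasing sequences lam_0 >= lam_1 >= ... >= lam_(d-1)
   of parts in [0, d], padded with zeros, summing to d. Each partition of d has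
   exactly one such representation. *)
Definition is_partition (d : nat) (lam : {ffun 'I_d -> 'I_d.+1}) : bool :=
  [forall i : 'I_d, forall j : 'I_d, (i <= j)%N ==> (lam j <= lam i)%N]
  && ((\sum_(i < d) (lam i : nat))%N == d).

Definition conjpart (d : nat) (lam : {ffun 'I_d -> 'I_d.+1}) (j : nat) : nat :=
  #|[set i : 'I_d | (j < lam i)%N]|.

(* Hook length of the cell in (0-indexed) row i, column j (j < lam_i). *)
Definition hook (d : nat) (lam : {ffun 'I_d -> 'I_d.+1}) (i : 'I_d) (j : nat) : nat :=
  (lam i - j + conjpart lam j - i - 1)%N.

Local Open Scope ring_scope.

(* m_{lam,r} = prod_{u in lam} (r + c(u)) / h(u), content c(i,j) = j - i. *)
Definition mfrak (d : nat) (lam : {ffun 'I_d -> 'I_d.+1}) (r : int) : rat :=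
  \prod_(i < d) \prod_(j < d | (j < lam i)%N)
     ((r%:~R + (j%:R - i%:R)) / (hook lam i j)%:R).

Definition cfrak (d : nat) (lam : {ffun 'I_d -> 'I_d.+1}) (r : nat) : rat :=
  \sum_(j < r.+1) (-1) ^+ j * ('C(r, j))%:R * mfrak lam (r - j)%:Z.

(* Number of fixed points of s acting on ordered set partitions ("tabloids")
   of 'I_d into blocks indexed by 'I_d with block sizes alpha_i
   (0 if some alpha_i < 0): this is the permutation character of the Young
   subgroup S_alpha, evaluated at s. *)
Definition tabloid_fix (d : nat) (s : {perm 'I_d}) (alpha : 'I_d -> int) : nat :=
  #|[set f : {ffun 'I_d -> 'I_d} |
      [forall x, f (s x) == f x] &&
      [forall i, (#|[set x | f x == i]| : int) == alpha i]]|.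

(* Irreducible character chi^lam of S_d, defined by the Frobenius/Jacobi-Trudi
   determinantal formula chi^lam = sum_{w in S_d} sgn(w) * 1_{S_alpha(w)}^{S_d},
   alpha(w)_i = lam_i - i + w(i). *)
Definition chi (d : nat) (lam : {ffun 'I_d -> 'I_d.+1}) (s : {perm 'I_d}) : int :=
  \sum_(w : {perm 'I_d})
     (-1) ^+ odd_perm w * (tabloid_fix s (fun i => (lam i)%:Z - (i : nat)%:Z + (w i : nat)%:Z))%:Z.

Definition dimp (d : nat) (lam : {ffun 'I_d -> 'I_d.+1}) : int := chi lam 1%g.

Definition chiC (d : nat) (lam : {ffun 'I_d -> 'I_d.+1}) (C : {set {perm 'I_d}}) : int :=
  chi lam (repr C).

Definition Wdr (d t r : nat) (C : 'I_t -> {set {perm 'I_d}}) : rat :=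
  (\prod_(i < t) (#|C i|)%:R) / (r`!)%:R *
  \sum_(lam : {ffun 'I_d -> 'I_d.+1} | is_partition lam)
     cfrak lam r * ((dimp lam)%:~R ^- t.-1) * \prod_(i < t) (chiC lam (C i))%:~R.

Definition xi (d t m : nat) (C : 'I_t -> {set {perm 'I_d}}) : nat :=
  #|[set sg : {ffun 'I_t -> {perm 'I_d}} |
      [forall i, sg i \in C i] && (ncycles (compprod sg) == m)]|.

(* Main.v *)
(** The generating polynomial [p(X) = sum X^(ncycles (s_1 ... s_t))] over all
    tuples with [s_i] in [C_i] is expanded in two ways. On one side its
    coefficients are the numbers [xi]. On the other side
    [X^(ncycles g) = sum_lam chi^lam(g) m_lam(X)], and each [chi^lam] is, up to
    sign, an irreducible character, so that class sums act as scalars and the sum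
    of [chi^lam] over tuples factors. Newton's formula writes [p] in the basis of
    falling factorials; its coordinates are the [W_r], and the coefficients of
    the falling factorials are signed Stirling numbers.

    Both facts about [chi^lam] come from the Jacobi-Trudi identity
    [a_(lam + delta) = det(h) a_delta] in [d] variables: [chi^lam(g)] is the
    coefficient of [x^(lam + delta)] in [a_delta p_g], where [p_g] is the power
    sum of the cycle type of [g]. Antisymmetry then gives
    [p_g = sum_lam chi^lam(g) det(h)], while counting orbits of pairs of
    colorings gives [sum_g chi^lam(g) p_g = d! det(h)], hence
    [sum_g chi^lam(g)^2 = d!]. At [x = (1^r, 0^(d-r))] the determinant is
    [m_lam(r)], by the hook-content formula. *)

Require Import Defs.
From mathcomp Require Import all_boot all_order all_algebra all_fingroup.
From mathcomp Require Import all_field all_character.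
From mathcomp.multinomials Require Import mpoly.
From mathcomp Require Import ring zify.
Set Implicit Arguments. Unset Strict Implicit. Unset Printing Implicit Defensive.
Import Order.TTheory GRing.Theory Num.Theory.
Local Open Scope ring_scope.

(** * Colorings fixed by a permutation *)

Section OrbitCounting.

Variables (n : nat) (U : finType).
Implicit Types (F : {ffun 'I_n -> U}) (A : {ffun U -> 'I_n.+1}).

(** Values in ['I_n.+1] make the multiplicity vectors a finite type; [inord] never truncates, since
    a fiber has at most [n] points. *)
Definition multiplicities F : {ffun U -> 'I_n.+1} :=
  [ffun u => inord #|[set x | F x == u]|].

Lemma multiplicitiesE F u : multiplicities F u = #|[set x | F x == u]| :> nat.
Proof.
by rewrite ffunE inordK // ltnS -[X in (_ <= X)%N](card_ord n) max_card.
Qed.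

Lemma card_fiber F u :
  #|[set x | F x == u]| = count_mem u [tuple F x | x < n].
Proof.
rewrite cardE -size_filter /= filter_map size_map enumT /enum_mem; congr size.
by apply: eq_filter => x; rewrite /= !inE.
Qed.

Lemma sum_multiplicities F : (\sum_u multiplicities F u)%N = n.
Proof.
under eq_bigr => u _ do rewrite multiplicitiesE -sum1_card.
rewrite (exchange_big_dep predT) //=.
rewrite -[RHS](card_ord n) -sum1_card; apply: eq_bigr => x _.
by rewrite (big_pred1 (F x)) // => u; rewrite inE eq_sym.
Qed.

(** Equal multiplicities make the two lists of values permutations of each other. *)
Lemma multiplicities_perm F0 F :
  multiplicities F = multiplicities F0 ->
  exists p : {perm 'I_n}, forall x, F x = F0 (p x).
Proof.
move=> eqF.
have : perm_eq [tuple F x | x < n] [tuple F0 x | x < n].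
  apply/allP => u _ /=; apply/eqP.
  by rewrite -!card_fiber -!multiplicitiesE eqF.
case/tuple_permP => p Ep; exists p => x.
move/val_inj: Ep => /(congr1 (fun t => tnth t x)).
by rewrite !tnth_mktuple.
Qed.

Lemma multiplicities_surj A :
  (\sum_u A u)%N = n -> exists F, multiplicities F = A.
Proof.
move=> sumA; pose s := flatten [seq nseq (A u) u | u <- enum U].
have size_s : size s == n.
  rewrite size_flatten /shape -map_comp -[X in _ == X]sumA sumnE big_map big_enum /=.
  by apply/eqP/eq_bigr => u _; rewrite size_nseq.
exists [ffun x => tnth (Tuple size_s) x].
apply/ffunP => u; apply: val_inj; rewrite /= multiplicitiesE card_fiber.
have -> : [tuple [ffun x => tnth (Tuple size_s) x] x | x < n] = Tuple size_s.
  by apply: eq_from_tnth => x; rewrite tnth_mktuple ffunE.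
rewrite /= count_flatten -map_comp sumnE big_map big_enum /= (bigD1 u) //=.
rewrite count_nseq /= eqxx mul1n big1 ?addn0 // => v /negPf vu.
by rewrite count_nseq /= vu.
Qed.

(* The stabilizer of [F] has as many elements as the set of [s] with
   [F = F0 \o s], and these sets partition the symmetric group. *)
Lemma sum_card_stabilizers A : (\sum_u A u)%N = n ->
  (\sum_(F | multiplicities F == A)
     #|[set s : {perm 'I_n} | [forall x, F (s x) == F x]]|)%N = n`!.
Proof.
case/multiplicities_surj => F0 <-.
rewrite -card_Sn -sum1_card.
transitivity (\sum_(F | multiplicities F == multiplicities F0)
   \sum_(s : {perm 'I_n} | F == [ffun x => F0 (s x)]) 1)%N.
  apply: eq_bigr => F /eqP /multiplicities_perm[p pE].
  rewrite -sum1_card [RHS](reindex_inj (mulIg p)) /=; apply: eq_bigl => s.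
  rewrite inE; apply/forallP/eqP => [Fs | Fs x].
    by apply/ffunP => x; rewrite ffunE permM -pE (eqP (Fs x)).
  by apply/eqP; rewrite {2}Fs ffunE permM pE.
rewrite (exchange_big_dep predT) //=; apply: eq_big => [s | s _]; first by rewrite inE.
rewrite (big_pred1 [ffun x => F0 (s x)]) // => F.
rewrite andb_idl // => /eqP -> {F}; apply/eqP/ffunP => u; apply: val_inj.
rewrite /= !multiplicitiesE -[RHS](card_imset _ (@perm_inj _ s^-1)).
apply: eq_card => x; rewrite !inE ffunE.
apply/idP/imsetP => [sx | [y]]; last by rewrite inE => yu ->; rewrite permKV.
by exists (s x); rewrite ?permK // inE.
Qed.

(** Burnside's count with weights: after exchanging the sums, each multiplicity vector [A] is met
    $n!$ times in all, by [sum_card_stabilizers]. *)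
Lemma sum_fixed_colorings (V : nmodType) (w : {ffun U -> 'I_n.+1} -> V) :
  \sum_(s : {perm 'I_n}) \sum_(F : {ffun 'I_n -> U} | [forall x, F (s x) == F x])
     w (multiplicities F) =
  (\sum_(A : {ffun U -> 'I_n.+1} | (\sum_u A u)%N == n) w A) *+ n`!.
Proof.
rewrite (exchange_big_dep predT) //= (partition_big multiplicities predT) //=.
rewrite (bigID (fun A : {ffun U -> 'I_n.+1} => (\sum_u A u)%N == n)) /=.
rewrite [X in _ + X]big1 ?addr0; last first.
  move=> A nA; rewrite big1 // => F /eqP EF.
  by rewrite -EF sum_multiplicities eqxx in nA.
rewrite -sumrMnl; apply: eq_bigr => A /eqP sumA.
rewrite -(sum_card_stabilizers sumA) -sumrMnr; apply: eq_bigr => F /eqP EF.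
by rewrite EF sumr_const; congr (_ *+ _); apply: eq_card => s; rewrite !inE.
Qed.

End OrbitCounting.

(** A coloring fixed by [s] amounts to one color per cycle. Such choices are encoded as functions on
    all subsets of [T], with the default value [u0] outside [porbits s]. *)
Lemma card_fixed_colorings (T U : finType) (s : {perm T}) (B : {set U}) (u0 : U) :
  #|[set f : {ffun T -> U} | [forall x, f (s x) == f x] && [forall x, f x \in B]]|
  = (#|B| ^ ncycles s)%N.
Proof.
rewrite /ncycles -(card_pffun_on u0).
pose h (c : {ffun {set T} -> U}) : {ffun T -> U} := [ffun x => c (porbit s x)].
have h_inj : {in pffun_on u0 (mem (porbits s)) (mem B) &, injective h}.
  move=> c1 c2 /pfamilyP[/subsetP s1 _] /pfamilyP[/subsetP s2 _] /ffunP eqh.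
  apply/ffunP => O; have [/imsetP[x _ ->]|nO] := boolP (O \in porbits s).
    by have := eqh x; rewrite !ffunE.
  have c0 (c : {ffun {set T} -> U}) :
      {subset u0.-support c <= mem (porbits s)} -> c O = u0.
    by move=> sc; apply: contraNeq nO => cO; apply: sc; rewrite inE.
  by rewrite !c0.
rewrite -(card_in_imset h_inj); apply: eq_card => f; rewrite inE.
apply/andP/imsetP => [[/forallP fs /forallP fB] | [c /pfamilyP[_ cB] ->]]; last first.
  split; apply/forallP => x; rewrite !ffunE.
    by rewrite -(porbit_perm s 1 x) expg1.
  by apply: cB; apply: imset_f.
have fi x i : f ((s ^+ i)%g x) = f x.
  by elim: i => [|i IH]; rewrite ?perm1 // expgSr permM (eqP (fs _)).
pose c : {ffun {set T} -> U} :=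
  [ffun O => if [pick x | O == porbit s x] is Some x then f x else u0].
exists c.
  apply/pfamilyP; split.
    apply/subsetP => O; rewrite inE ffunE; case: pickP => [x /eqP -> _|_]; last by rewrite eqxx.
    exact: imset_f.
  move=> O /imsetP[x _ ->]; rewrite ffunE; case: pickP => [y _|/(_ x)]; first exact: fB.
  by rewrite eqxx.
apply/ffunP => x; rewrite !ffunE; case: pickP => [y|/(_ x)]; last by rewrite eqxx.
move/eqP => exy; have : y \in porbit s x by rewrite exy porbit_id.
by case/porbitP => i ->; rewrite fi.
Qed.

Lemma card_ord_lt d n : (n <= d)%N -> #|[set k : 'I_d | (k < n)%N]| = n.
Proof.
move=> nd; rewrite -sum1_card (eq_bigl (fun k : 'I_d => (k < n)%N)) => [|k]; last by rewrite inE.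
by rewrite -(big_ord_widen d (fun=> 1%N)) // sum1_card card_ord.
Qed.

(** * Complete symmetric functions *)

Section CompleteSymmetric.

Variables (R : comNzRingType) (d : nat) (x : 'I_d -> R).

(** The series $1/(1-aX)$ modulo $X^N$. *)
Definition geom N (a : R) : {poly R} := \poly_(k < N) a ^+ k.

Lemma eq_coef_prod (I : finType) (P : pred I) (p q : I -> {poly R}) n :
  (forall i k, (k <= n)%N -> (p i)`_k = (q i)`_k) ->
  forall k, (k <= n)%N ->
  (\prod_(i | P i) p i)`_k = (\prod_(i | P i) q i)`_k.
Proof.
move=> pq; pose K (p q : {poly R}) := forall k, (k <= n)%N -> p`_k = q`_k.
rewrite -/(K _ _); apply: (big_ind2 K) => // [p1 q1 p2 q2 K1 K2 k kn | i _ k kn].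
  rewrite !coefM; apply: eq_bigr => i _.
  by rewrite K1 ?K2 // (leq_trans _ kn) ?leq_subr // -ltnS.
exact: pq.
Qed.

(** The complete symmetric function $h_n$, read off from $\prod_i 1/(1-x_iX)$; truncating the
    factors past degree [n] does not affect this coefficient. *)
Definition hsym n : R := (\prod_i geom n.+1 (x i))`_n.

Lemma hsym_coef N n : (n < N)%N -> hsym n = (\prod_i geom N (x i))`_n.
Proof.
move=> nN; apply: (@eq_coef_prod _ _ _ _ n) => // i k kn.
by rewrite !coef_poly ltnS kn (leq_ltn_trans kn nN).
Qed.

Lemma hsym_sum N n : (n < N)%N ->
  hsym n = \sum_(A : {ffun 'I_d -> 'I_N} | (\sum_i A i)%N == n)
              \prod_i x i ^+ A i.
Proof.
move=> nN; rewrite (hsym_coef nN) /geom.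
under eq_bigr => i _ do rewrite poly_def.
rewrite bigA_distr_bigA coef_sum [RHS]big_mkcond /=; apply: eq_bigr => A _.
under eq_bigr => i _ do rewrite -mul_polyC.
rewrite big_split /= prodrXr -rmorph_prod coefCM coefXn eq_sym.
by case: ifP => _; rewrite (mulr1, mulr0).
Qed.

Lemma hsym0 : hsym 0 = 1.
Proof.
rewrite /hsym -horner_coef0 horner_prod big1 // => i _.
by rewrite horner_coef0 coef_poly expr0.
Qed.

(** The convention $h_n = 0$ for $n < 0$ of Jacobi-Trudi determinants. *)
Definition hsymz (n : int) : R := if n is Posz k then hsym k else 0.

Lemma hsymz_sub (a b : nat) :
  hsymz (a%:Z - b%:Z) = if (b <= a)%N then hsym (a - b) else 0.
Proof.
case: leqP => [ba|ab]; first by rewrite subzn.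
have -> : a%:Z - b%:Z = Negz (b - a).-1 by lia.
by [].
Qed.

(** Its coefficients are, up to alternating signs, the elementary symmetric functions of the
    variables other than [x j]. *)
Definition coelem j : {poly R} := \prod_(l | l != j) (1 - x l *: 'X).

Lemma size_coelem j : (size (coelem j) <= d)%N.
Proof.
apply: leq_trans (size_poly_prod_leq _ _) _.
have sz l : (size (1 - x l *: 'X : {poly R})%R <= 2)%N.
  rewrite (leq_trans (size_polyD _ _)) // geq_max size_poly1 /= size_polyN.
  by rewrite (leq_trans (size_scale_leq _ _)) // size_polyX.
have card_j : #|[pred l : 'I_d | l != j]| = d.-1 by have := cardC1 j; rewrite card_ord.
have : (\sum_(l | l != j) size (1 - x l *: 'X : {poly R})%R <= \sum_(l | l != j) 2)%N.
  by apply: leq_sum => l _; apply: sz.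
rewrite sum_nat_const card_j.
by have := ltn_ord j; lia.
Qed.

(** Up to degree [n] the factors of index other than [j] cancel, which leaves the geometric series
    of [x j]. *)
Lemma coef_geom_coelem j n :
  (\prod_l geom n.+1 (x l) * coelem j)`_n = x j ^+ n.
Proof.
rewrite (bigD1 j) //= -mulrA -big_split /=.
have -> : x j ^+ n = (geom n.+1 (x j) * \prod_(l | l != j) 1)`_n.
  by rewrite big1_eq mulr1 coef_poly ltnSn.
have EP : \prod_(l | l != j) (geom n.+1 (x l) * (1 - x l *: 'X)) =
          \prod_(l | l != j) (1 - (x l *: 'X) ^+ n.+1).
  apply: eq_bigr => l _; rewrite -[RHS]opprB subrX1 -mulNr opprB mulrC /geom poly_def.
  by congr (_ * _); apply: eq_bigr => i _; rewrite exprZn.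
rewrite EP !coefM; apply: eq_bigr => i _; congr (_ * _).
apply: (@eq_coef_prod _ _ _ _ n) (leq_subr _ _) => l k kn.
by rewrite coefB exprZn coefZ coefXn ltn_eqF ?ltnS // mulr0 subr0.
Qed.

Lemma power_hsymz j n :
  x j ^+ n = \sum_(k < d) hsymz (n%:Z - (rev_ord k : nat)%:Z) * (coelem j)`_(rev_ord k).
Proof.
rewrite -coef_geom_coelem coefMr [RHS](reindex_inj rev_ord_inj).
under [RHS]eq_bigr => k _ do rewrite rev_ordK hsymz_sub.
(* The two sums run over [k <= n] and over [k < d]. Both extend to one common range, since [S]
   vanishes past [n] by definition and from [d] on by the degree of [coelem j]. *)
pose S k := if (k <= n)%N then hsym (n - k) * (coelem j)`_k else 0.
transitivity (\sum_(k < d + n.+1) S k).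
  rewrite (big_ord_widen (d + n.+1)
    (fun k => (\prod_l geom n.+1 (x l))`_(n - k) * (coelem j)`_k)) ?leq_addl //.
  rewrite big_mkcond /=; apply: eq_bigr => k _; rewrite ltnS /S; case: leqP => // kn.
  by rewrite -hsym_coef // ltnS leq_subr.
rewrite (eq_bigr (fun k : 'I_d => S k)); last first.
  by move=> k _; rewrite /S; case: ifP; rewrite ?mul0r.
rewrite [RHS](big_ord_widen (d + n.+1)) ?leq_addr //.
rewrite [RHS]big_mkcond /=; apply: eq_bigr => k _; case: ltnP => // dk.
by rewrite /S nth_default ?mulr0 ?if_same // (leq_trans (size_coelem j)).
Qed.

Definition alternant (a : 'I_d -> nat) : R := \det (\matrix_(i, j) x j ^+ a i).

(** For [a] equal to $\lambda+\delta$ the entry is $h_{\lambda_i-i+k}$, as in the usual Jacobi-Trudi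
    matrix; [rev_ord k] compensates $\delta$. *)
Definition jtmx (a : 'I_d -> nat) : 'M[R]_d :=
  \matrix_(i, k) hsymz ((a i)%:Z - (rev_ord k : nat)%:Z).

Definition staircase (i : 'I_d) : nat := rev_ord i.

(* [power_hsymz] says that the matrix [x_j ^ a_i] is the product of [jtmx a] with
   a matrix [E] not depending on [a]; for [a] the staircase, [jtmx a] is
   unitriangular, so [\det E] is the Vandermonde determinant. *)
Theorem jacobi_trudi a : alternant a = \det (jtmx a) * alternant staircase.
Proof.
pose E : 'M[R]_d := \matrix_(k, j) (coelem j)`_(rev_ord k).
have altE b : alternant b = \det (jtmx b) * \det E.
  rewrite -det_mulmx; congr (\det _); apply/matrixP => i j; rewrite !mxE.
  by rewrite power_hsymz; apply: eq_bigr => k _; rewrite !mxE.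
rewrite !altE -[\det (jtmx staircase)]det_tr det_trig; last first.
  apply/is_trig_mxP => i j ij; rewrite !mxE hsymz_sub /staircase.
  by rewrite ifF //=; have := ltn_ord j; lia.
rewrite [X in _ = _ * (X * _)]big1 ?mul1r // => i _.
by rewrite !mxE subrr /= hsym0.
Qed.

End CompleteSymmetric.

Lemma rmorph_hsymz (R S : comNzRingType) (f : {rmorphism R -> S}) d (x : 'I_d -> R) n :
  f (hsymz x n) = hsymz (f \o x) n.
Proof.
case: n => n /=; last by rewrite rmorph0.
rewrite !(hsym_sum _ (ltnSn n)) rmorph_sum; apply: eq_bigr => A _.
by rewrite rmorph_prod; apply: eq_bigr => i _; rewrite rmorphXn.
Qed.

(** The binomial coefficient $\binom{X+n-1}{n}$, whose value at [r] is $h_n$ at [r] ones. *)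
Definition rising n : {poly rat} := n`!%:R^-1 *: \prod_(k < n) ('X + k%:R%:P).

Lemma horner_rising n a : (rising n).[a] = (\prod_(k < n) (a + k%:R)) / n`!%:R.
Proof.
rewrite /rising hornerZ horner_prod mulrC; congr (_ / _).
by apply: eq_bigr => k _; rewrite !hornerE.
Qed.

Lemma rising_pascal n a :
  (rising n.+1).[a + 1] = (rising n).[a + 1] + (rising n.+1).[a].
Proof.
have nz k : (k`!)%:R != 0 :> rat by rewrite pnatr_eq0 -lt0n fact_gt0.
have nz1 : (n.+1)%:R != 0 :> rat by rewrite pnatr_eq0.
rewrite !horner_rising factS natrM big_ord_recr big_ord_recl /=.
have -> : \prod_(i < n) (a + (bump 0 i)%:R) = \prod_(i < n) (a + 1 + i%:R).
  by apply: eq_bigr => i _; rewrite /bump /= natrD; ring.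
by rewrite -!natr1 in nz1 *; field; rewrite nz nz1.
Qed.

Lemma rising_sum n (r : nat) :
  (rising n).[(r.+1)%:R] = \sum_(k < n.+1) (rising k).[r%:R].
Proof.
elim: n => [|n IH].
  by rewrite big_ord1 !horner_rising !big_ord0.
by rewrite big_ord_recr /= -IH -natr1 rising_pascal.
Qed.

(** Multiplication by $1/(1-X)$ replaces coefficients by their partial sums, which [rising_sum]
    evaluates. *)
Lemma coef_geomX N n r : (n < N)%N ->
  (geom N (1 : rat) ^+ r)`_n = (rising n).[r%:R].
Proof.
elim: r n => [|r IH] n nN.
  rewrite expr0 coef1 horner_rising; case: n nN => [|n] nN.
    by rewrite big_ord0.
  by rewrite big_ord_recl add0r !mul0r.
rewrite rising_sum exprSr coefM; apply: eq_bigr => i _.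
rewrite IH ?coef_poly; last by rewrite (leq_ltn_trans _ nN) // -ltnS.
by rewrite expr1n (leq_ltn_trans (leq_subr _ _) nN) mulr1.
Qed.

Lemma hsym_ones d r n : (r <= d)%N ->
  hsym (fun i : 'I_d => (i < r)%N%:R : rat) n = (rising n).[r%:R].
Proof.
move=> rd; rewrite -(coef_geomX _ (ltnSn n)) /hsym.
rewrite (bigID (fun i : 'I_d => (i < r)%N)) /= [X in _ * X]big1 ?mulr1; last first.
  move=> i /negPf ->; apply/polyP => k; rewrite coef_poly coef1 expr0n.
  by case: k => //= k; rewrite if_same.
rewrite (eq_bigr (fun=> geom n.+1 1)) => [|i ->] //.
by rewrite -(big_ord_widen d (fun=> geom n.+1 1)) // prodr_const card_ord.
Qed.

(** * Alternants and the characters [chi] *)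

Lemma eq_tabloid_fix d (s : {perm 'I_d}) (a b : 'I_d -> int) :
  a =1 b -> tabloid_fix s a = tabloid_fix s b.
Proof.
move=> ab; apply: eq_card => f; rewrite !inE; congr (_ && _).
by apply: eq_forallb => i; rewrite ab.
Qed.

Lemma tabloid_fix_neg d (s : {perm 'I_d}) (a : 'I_d -> int) i :
  a i < 0 -> tabloid_fix s a = 0%N.
Proof.
move=> ai; apply: eq_card0 => f; rewrite !inE; apply/negP => /andP[_ /forallP/(_ i)].
by move/eqP=> E; rewrite -E in ai.
Qed.

(** * Strictly decreasing exponent sequences *)

Section Decreasing.
Variable d : nat.
Implicit Types (a b : 'I_d -> nat) (w : {perm 'I_d}).

Definition strictly_decreasing a := forall i j : 'I_d, (i < j)%N -> (a j < a i)%N.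

Lemma perm_leq_homo w :
  (forall i j : 'I_d, (i < j)%N -> (w i < w j)%N) -> forall i : 'I_d, (i <= w i)%N.
Proof.
move=> hw i; have [n] := ubnP (i : nat); elim: n i => // n IH i.
rewrite ltnS => lein; case Ei: (i : nat) => [//|k].
have kd : (k < d)%N by have := ltn_ord i; lia.
have := IH (Ordinal kd); rewrite /= => /(_ ltac:(lia)).
by have := hw (Ordinal kd) i; rewrite /= Ei ltnSn => /(_ isT); lia.
Qed.

(** Comparing orders shows that [w] is increasing, and so is its inverse; by [perm_leq_homo] neither
    lowers an index, so both are trivial. *)
Lemma strictly_decreasing_perm a b w :
  strictly_decreasing a -> strictly_decreasing b ->
  (forall i, a (w i) = b i) -> w = 1%g.
Proof.
move=> da db ab.
have mono : forall i j : 'I_d, (i < j)%N -> (w i < w j)%N.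
  move=> i j ij; have := db i j ij; rewrite -!ab.
  case: (ltngtP (w i) (w j)) => // [ji | /val_inj ->]; last by rewrite ltnn.
  by have := da _ _ ji; lia.
have monoV : forall i j : 'I_d, (i < j)%N -> ((w^-1)%g i < (w^-1)%g j)%N.
  move=> i j ij; rewrite ltnNge; apply/negP; rewrite leq_eqVlt => /orP[/eqP/val_inj/perm_inj E|].
    by rewrite E ltnn in ij.
  by move/mono; rewrite !permKV; lia.
apply/permP => i; apply: val_inj; rewrite perm1; apply/eqP; rewrite eqn_leq.
rewrite perm_leq_homo // andbT.
by have := perm_leq_homo monoV (w i); rewrite permK.
Qed.

Lemma sorting_perm a : injective a ->
  exists w : {perm 'I_d}, strictly_decreasing (a \o w).
Proof.
move=> inj_a; pose t := [tuple a i | i < d].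
have /tuple_permP[w Ew] : perm_eq (sort geq t) t by rewrite perm_sort.
exists w => i j ij /=.
have := sorted_leq_nth (leT := geq) (rev_trans leq_trans) leqnn 0%N
          (sort_sorted (fun x y => leq_total y x) t).
have sz : size (sort geq t) = d by rewrite size_sort size_tuple.
move/(_ i j); rewrite !inE sz !ltn_ord => /(_ isT isT (ltnW ij)).
rewrite Ew -!tnth_nth !tnth_mktuple /= leq_eqVlt => /orP[/eqP/inj_a/perm_inj E|//].
by rewrite E ltnn in ij.
Qed.

End Decreasing.

(** The exponent vector $\lambda+\delta$ with $\delta=(d-1,\ldots,0)$. *)
Definition shifted d (lam : {ffun 'I_d -> 'I_d.+1}) (i : 'I_d) : nat :=
  (lam i + rev_ord i)%N.

Lemma partition_dec d (lam : {ffun 'I_d -> 'I_d.+1}) : is_partition lam ->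
  forall i j : 'I_d, (i <= j)%N -> (lam j <= lam i)%N.
Proof. by case/andP => /forallP dec _ i j ij; have /forallP/(_ j)/implyP := dec i; apply. Qed.

Lemma strictly_decreasing_shifted d (lam : {ffun 'I_d -> 'I_d.+1}) :
  is_partition lam -> strictly_decreasing (shifted lam).
Proof.
move=> plam i j ij; have := partition_dec plam (ltnW ij); rewrite /shifted /=.
by have := ltn_ord j; lia.
Qed.

(** * Alternants, power sums and the Frobenius formula *)

Section Alternants.
Variable d : nat.
Local Notation mp := {mpoly rat[d]}.
Local Notation X := (fun i : 'I_d => 'X_i : mp).
Implicit Types (a : 'I_d -> nat) (g w s : {perm 'I_d}) (p : mp).

Definition mnm_of a : 'X_{1..d} := [multinom a i | i < d].

Lemma alternantX a :
  alternant X a = \sum_(w : {perm 'I_d}) (-1) ^+ w *: 'X_[mnm_of (a \o w)].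
Proof.
rewrite /alternant -det_tr; apply: eq_bigr => w _.
rewrite scaler_sign -mulr_sign mpolyXE_id; congr (_ * _).
by apply: eq_bigr => i _; rewrite !mxE mnmE.
Qed.

Definition antisymmetric_mpoly p := forall s, msym s p = (-1) ^+ s *: p.

Lemma alternant_antisym a : antisymmetric_mpoly (alternant X a).
Proof.
move=> s; rewrite alternantX raddf_sum scaler_sumr.
rewrite (reindex_inj (mulgI s)) /=; apply: eq_bigr => w _.
rewrite linearZ /= msymX scalerA -signr_addb; congr ((-1) ^+ _ *: 'X_[_]).
  by rewrite odd_permM.
by apply/mnmP => i; rewrite !mnmE /= permM permKV.
Qed.

Lemma antisym_coef p s (m : 'X_{1..d}) :
  antisymmetric_mpoly p -> p@_[multinom m (s i) | i < d] = (-1) ^+ s * p@_m.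
Proof. by move=> ap; rewrite -mcoeff_sym ap mcoeffZ. Qed.

(** Swapping the two equal exponents fixes the monomial and negates its coefficient. *)
Lemma antisym_coef0 p (m : 'X_{1..d}) (i j : 'I_d) :
  antisymmetric_mpoly p -> i != j -> m i = m j -> p@_m = 0.
Proof.
move=> ap ij mij; have := antisym_coef (tperm i j) m ap.
have -> : [multinom m (tperm i j k) | k < d] = m.
  by apply/mnmP => k; rewrite mnmE; case: tpermP => [->|->|].
rewrite odd_tperm ij expr1 mulN1r => /eqP; rewrite -addr_eq0 -mulr2n mulrn_eq0 /=.
by move/eqP.
Qed.

(** A repeated exponent forces a zero coefficient, and any other exponent vector can be sorted into
    a strictly decreasing one at the cost of a sign. *)
Lemma eq_antisym p q : antisymmetric_mpoly p -> antisymmetric_mpoly q ->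
  (forall a, strictly_decreasing a -> p@_(mnm_of a) = q@_(mnm_of a)) -> p = q.
Proof.
move=> ap aq pq; apply/mpolyP => m.
have [inj_m | /injectivePn[i [j ij mij]]] := altP (injectiveP m); last first.
  by rewrite (antisym_coef0 ap ij mij) (antisym_coef0 aq ij mij).
have [w dw] := sorting_perm inj_m.
have Em : mnm_of (m \o w) = [multinom m (w i) | i < d] by apply/mnmP => i; rewrite !mnmE.
have := pq _ dw; rewrite Em !antisym_coef // => /(congr1 ( *%R ((-1) ^+ w))).
by rewrite !mulrA -expr2 sqrr_sign !mul1r.
Qed.

(** Only the identity term of the Leibniz expansion has a strictly decreasing exponent. *)
Lemma alternant_coef a b : strictly_decreasing a -> strictly_decreasing b ->
  (alternant X a)@_(mnm_of b) = [forall i, a i == b i]%:R.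
Proof.
move=> da db; rewrite alternantX raddf_sum (bigD1 1%g) //= big1 => [|w w1].
  rewrite addr0 odd_perm1 scale1r mcoeffX; congr (_%:R); congr nat_of_bool.
  apply/eqP/forallP => [/mnmP E i | E]; first by have := E i; rewrite !mnmE /= perm1 => ->.
  by apply/mnmP => i; rewrite !mnmE /= perm1 (eqP (E i)).
rewrite mcoeffZ mcoeffX; case: eqP => [/mnmP E|]; rewrite ?mulr0 //.
case/eqP: w1; apply: (strictly_decreasing_perm da db) => i.
by have := E i; rewrite !mnmE.
Qed.

Lemma alternant_homog a : alternant X a \is (\sum_i a i)%N.-homog.
Proof.
rewrite alternantX; apply: rpred_sum => w _; apply: rpredZ.
rewrite dhomogX; apply/eqP; rewrite /= mdegE [RHS](reindex_inj (@perm_inj _ w)).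
by apply: eq_bigr => i _; rewrite mnmE.
Qed.

Lemma strictly_decreasing_staircase : strictly_decreasing (@staircase d).
Proof. by move=> i j ij; rewrite /staircase /=; have := ltn_ord j; lia. Qed.

Lemma vandermonde_neq0 : alternant X (@staircase d) != 0.
Proof.
apply/eqP => E; have := alternant_coef strictly_decreasing_staircase strictly_decreasing_staircase.
rewrite E mcoeff0 => /esym/eqP; rewrite pnatr_eq0 eqb0 => /negP; apply.
by apply/forallP.
Qed.

Lemma mcoeffXM (p : mp) m k :
  ('X_[m] * p)@_k = if (m <= k)%MM then p@_(k - m) else 0.
Proof.
case: ifP => [mk | mk]; first by rewrite mulrC -{1}(submK mk) addmC mcoeffMX.
rewrite {1}[p]mpolyE mulr_sumr raddf_sum big1 // => m' _ /=.
rewrite -scalerAr mcoeffZ -mpolyXD mcoeffX; case: eqP => [E|_]; last by rewrite mulr0.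
by rewrite -E lem_addr ?lemm in mk.
Qed.

(** The product, over the cycles of [g], of the power sums $\sum_i x_i^\ell$ with $\ell$ the cycle
    length, in expanded form: a coloring fixed by [g] picks one variable for each cycle. *)
Definition powersum g : mp :=
  \sum_(f : {ffun 'I_d -> 'I_d} | [forall x, f (g x) == f x]) \prod_x 'X_(f x).

Lemma prodX_content (f : {ffun 'I_d -> 'I_d}) :
  \prod_x 'X_(f x) = 'X_[mnm_of (fun i => #|[set x | f x == i]|)] :> mp.
Proof.
rewrite mprodXE; congr 'X_[_]; apply/mnmP => i; rewrite mnm_sumE mnmE.
rewrite -sum1_card [RHS]big_mkcond; apply: eq_bigr => x _.
by rewrite mnm1E inE; case: (_ == _).
Qed.

Lemma powersum_coef g m :
  (powersum g)@_m = (tabloid_fix g (fun i => (m i)%:Z))%:R.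
Proof.
rewrite /powersum raddf_sum /tabloid_fix -sum1_card natr_sum [RHS]big_mkcond /=.
rewrite big_mkcond; apply: eq_bigr => f _; rewrite inE; case: ifP => //= _.
rewrite prodX_content mcoeffX.
have -> : (mnm_of (fun i => #|[set x | f x == i]|) == m) =
          [forall i, #|[set x | f x == i]|%:Z == (m i)%:Z].
  apply/eqP/forallP => [/mnmP E i | E]; first by rewrite -E mnmE.
  by apply/mnmP => i; rewrite mnmE; apply/eqP; rewrite -eqz_nat; apply: E.
by case: ifP.
Qed.

Lemma powersum_sym g s : msym s (powersum g) = powersum g.
Proof.
rewrite /powersum raddf_sum.
pose h (f : {ffun 'I_d -> 'I_d}) : {ffun 'I_d -> 'I_d} := [ffun x => (s^-1)%g (f x)].
pose h' (f : {ffun 'I_d -> 'I_d}) : {ffun 'I_d -> 'I_d} := [ffun x => s (f x)].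
have hK : cancel h h' by move=> f; apply/ffunP => x; rewrite !ffunE permKV.
have h'K : cancel h' h by move=> f; apply/ffunP => x; rewrite !ffunE permK.
rewrite (reindex h); last by exists h' => f _.
apply: eq_big => [f | f _].
  apply: eq_forallb => x; rewrite !ffunE; exact: (inj_eq perm_inj).
rewrite /= rmorph_prod; apply: eq_bigr => x _ /=; rewrite msymX ffunE; congr 'X_[_].
apply/mnmP => i; rewrite mnmE !mnm1E; congr nat_of_bool.
exact: (inj_eq perm_inj).
Qed.

Lemma powersum_homog g : powersum g \is d.-homog.
Proof.
apply: rpred_sum => f _; rewrite mprodXE dhomogX /= mdeg_sum.
by under eq_bigr => i _ do rewrite mdeg1; rewrite sum1_card card_ord.
Qed.

Lemma mulr_antisym p q : antisymmetric_mpoly p -> (forall s, msym s q = q) ->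
  antisymmetric_mpoly (p * q).
Proof. by move=> ap sq s; rewrite rmorphM /= ap sq scalerAl. Qed.

(** The term of [w] in $a_\delta$ leaves the coefficient of [powersum g] at the exponent
    $\lambda_i-i+w(i)$, which is the index in the definition of [chi]. If one of these integers is
    negative, both terms vanish. *)
Lemma chi_coef lam g :
  (alternant X (@staircase d) * powersum g)@_(mnm_of (shifted lam)) = (chi lam g)%:~R.
Proof.
rewrite alternantX mulr_suml raddf_sum /chi rmorph_sum; apply: eq_bigr => w _ /=.
rewrite -scalerAl mcoeffZ mcoeffXM rmorphM rmorph_sign; congr (_ * _).
rewrite powersum_coef; case: ifP => [/mnm_lepP le_w | /negbT nle].
  congr (_%:R); apply: eq_tabloid_fix => i; have := le_w i.
  rewrite mnmBE !mnmE /shifted /staircase /= => le_i.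
  by have := ltn_ord i; have := ltn_ord (w i); lia.
suff [i Hi] : exists i : 'I_d, (lam i)%:Z - (i : nat)%:Z + (w i : nat)%:Z < 0.
  by rewrite (tabloid_fix_neg _ Hi).
have /forallPn[i Hi] : ~~ [forall i, (mnm_of (@staircase d \o w) i <= mnm_of (shifted lam) i)%N].
  by apply: contra nle => /forallP H; apply/mnm_lepP.
exists i; move: Hi; rewrite !mnmE /shifted /staircase /=.
by have := ltn_ord i; have := ltn_ord (w i); lia.
Qed.

Lemma strictly_decreasing_partition a :
  strictly_decreasing a -> (\sum_i a i = d + \sum_i @staircase d i)%N ->
  exists2 lam : {ffun 'I_d -> 'I_d.+1}, is_partition lam & forall i, shifted lam i = a i.
Proof.
move=> da suma.
(* Strict decrease gains one at each step. So subtracting the staircase leaves a weakly decreasing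
   sequence, and comparison with the last index shows that it is nonnegative. *)
have dist (i j : 'I_d) : (i <= j)%N -> (a j + (j - i) <= a i)%N.
  have [n] := ubnP (j - i)%N; elim: n i => // n IH i; rewrite ltnS => jin ij.
  move: ij; rewrite leq_eqVlt => /orP[/eqP/val_inj -> | ij]; first by rewrite subnn addn0.
  have id : (i.+1 < d)%N by have := ltn_ord j; lia.
  have := IH (Ordinal id); rewrite /= => /(_ ltac:(lia) ltac:(lia)).
  by have := da i (Ordinal id); rewrite /= ltnSn => /(_ isT); lia.
have ge_rev (i : 'I_d) : (rev_ord i <= a i)%N.
  have d0 : (d.-1 < d)%N by have := ltn_ord i; lia.
  have := dist i (Ordinal d0); have := ltn_ord i; rewrite /= => ? /(_ ltac:(lia)); lia.
have sumb : (\sum_i (a i - rev_ord i) = d)%N.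
  have : (\sum_i (a i - rev_ord i) + \sum_i @staircase d i = \sum_i a i)%N.
    by rewrite -big_split; apply: eq_bigr => i _; rewrite /staircase /= subnK //; apply: ge_rev.
  by rewrite suma => /eqP; rewrite eqn_add2r => /eqP.
have le_d i : (a i - rev_ord i < d.+1)%N.
  by rewrite ltnS -[X in (_ <= X)%N]sumb (bigD1 i) //= leq_addr.
exists [ffun i => Ordinal (le_d i)]; last first.
  by move=> i; rewrite /shifted ffunE /= subnK //; apply: ge_rev.
apply/andP; split; last by under eq_bigr => i _ do rewrite ffunE /=; apply/eqP.
apply/forallP => i; apply/forallP => j; apply/implyP => ij; rewrite !ffunE /=.
by have := dist _ _ ij; have := ltn_ord j; lia.
Qed.

Lemma sum_shifted (lam : {ffun 'I_d -> 'I_d.+1}) : is_partition lam ->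
  (\sum_i shifted lam i = d + \sum_i @staircase d i)%N.
Proof. by case/andP=> _ /eqP sl; rewrite /shifted big_split /= sl. Qed.

Lemma shifted_inj (lam mu : {ffun 'I_d -> 'I_d.+1}) :
  [forall i, shifted lam i == shifted mu i] = (lam == mu).
Proof.
apply/forallP/eqP => [E | -> //]; apply/ffunP => i; apply: val_inj.
by have /eqP := E i; rewrite /shifted => /addIn.
Qed.

(** Both sides are antisymmetric and homogeneous of degree $d+|\delta|$. The strictly decreasing
    exponents of that degree are the $\lambda+\delta$, where [chi_coef] and [alternant_coef] give
    the coefficients. *)
Lemma powersum_alternant g :
  alternant X (@staircase d) * powersum g =
  \sum_(lam | is_partition lam) (chi lam g)%:~R *: alternant X (shifted lam).
Proof.
have antiL := mulr_antisym (@alternant_antisym (@staircase d)) (powersum_sym g).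
apply: (eq_antisym antiL) => [s | a da].
  rewrite raddf_sum scaler_sumr; apply: eq_bigr => lam _ /=.
  by rewrite linearZ /= alternant_antisym scalerA mulrC -scalerA.
have [suma | suma] := eqVneq (\sum_i a i)%N (d + \sum_i @staircase d i)%N; last first.
  have deg : mdeg (mnm_of a) = (\sum_i a i)%N.
    by rewrite mdegE; apply: eq_bigr => i _; rewrite mnmE.
  rewrite (dhomog_nemf_coeff (dhomogM (alternant_homog _) (powersum_homog g))); last first.
    by rewrite /= deg addnC.
  rewrite raddf_sum big1 // => lam plam /=; rewrite mcoeffZ.
  rewrite (dhomog_nemf_coeff (alternant_homog _)) ?mulr0 //.
  by rewrite /= deg sum_shifted.
have [lam plam Elam] := strictly_decreasing_partition da suma.
have -> : mnm_of a = mnm_of (shifted lam) by apply/mnmP => i; rewrite !mnmE Elam.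
rewrite chi_coef [RHS]raddf_sum [RHS](bigD1 lam) //= [X in _ = _ + X]big1 => [|mu].
  rewrite mcoeffZ alternant_coef; [|exact: strictly_decreasing_shifted..].
  by rewrite shifted_inj eqxx mulr1 addr0.
case/andP => pmu mu_lam; rewrite mcoeffZ alternant_coef; [|exact: strictly_decreasing_shifted..].
by rewrite shifted_inj (negPf mu_lam) mulr0.
Qed.

(** Frobenius' formula: dividing by the Vandermonde alternant turns the alternant of
    $\lambda+\delta$ into the Schur function of $\lambda$, here in its determinantal form. *)
Lemma powersum_jacobi_trudi g :
  powersum g =
  \sum_(lam | is_partition lam) (chi lam g)%:~R *: \det (jtmx X (shifted lam)).
Proof.
apply: (mulfI vandermonde_neq0); rewrite powersum_alternant mulr_sumr.
apply: eq_bigr => lam _; rewrite (jacobi_trudi _ (shifted lam)) [RHS]mulrC.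
by rewrite -[RHS]scalerAl.
Qed.

End Alternants.

(** * Power sums at ones and the norm of [chi] *)

Definition risingz (n : int) : {poly rat} := if n is Posz k then rising k else 0.

(** The value $s_\lambda(1^r)$ of the Schur function as a polynomial in $r$. *)
Definition jtpoly d (lam : {ffun 'I_d -> 'I_d.+1}) : {poly rat} :=
  \det (\matrix_(i, k) risingz ((shifted lam i)%:Z - (rev_ord k : nat)%:Z)).

Section Powersum.
Variable d : nat.
Local Notation mp := {mpoly rat[d]}.
Local Notation X := (fun i : 'I_d => 'X_i : mp).
Implicit Types (g : {perm 'I_d}) (lam : {ffun 'I_d -> 'I_d.+1}).

(** At $(1^r,0^{d-r})$, a point that exists only for [r <= d], the power sum counts the colorings
    fixed by [g] that use only the first [r] colors. *)
Lemma expn_ncycles_le g r : (0 < d)%N -> (r <= d)%N ->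
  (r ^ ncycles g)%:R =
  \sum_(lam | is_partition lam) (chi lam g)%:~R * (jtpoly lam).[r%:R] :> rat.
Proof.
move=> d0 rd; pose v (i : 'I_d) : rat := (i < r)%N%:R.
have <- : meval v (powersum g) = (r ^ ncycles g)%:R.
  rewrite -{1}(card_ord_lt rd) -(card_fixed_colorings g _ (Ordinal d0)).
  rewrite /powersum raddf_sum /= -sum1_card natr_sum [LHS]big_mkcond [RHS]big_mkcond /=.
  apply: eq_bigr => f _; rewrite inE; case: ifP => //= _.
  rewrite rmorph_prod /=; under eq_bigr => x _ do rewrite mevalXU.
  case: ifP => [/forallP fB | /negbT/forallPn[x]].
    by rewrite big1 // => x _; have := fB x; rewrite inE /v => ->.
  by rewrite inE => /negPf fx; rewrite (bigD1 x) //= /v fx mul0r.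
rewrite powersum_jacobi_trudi raddf_sum; apply: eq_bigr => lam _ /=.
rewrite mevalZ -[meval v _](det_map_mx (meval v)) /jtpoly.
rewrite -[X in _ = _ * X](det_map_mx (horner_eval (r%:R : rat))).
congr (_ * \det _); apply/matrixP => i k; rewrite !mxE.
rewrite [LHS](rmorph_hsymz (meval v)) /= /horner_eval.
case: (_ - _) => n /=; last by rewrite horner0.
rewrite -(hsym_ones _ rd) /hsym; congr (nth 0 (polyseq _) n); apply: eq_bigr => j _ /=.
by rewrite mevalXU.
Qed.

(* A pair of colorings is a coloring by pairs, and its multiplicities form a
   matrix with row sums [a]. *)
Lemma sum_tabloid_fix_powersum (a : 'I_d -> int) : \sum_i a i = d%:Z ->
  \sum_g (tabloid_fix g a)%:R *: powersum g = (\prod_i hsymz X (a i)) *+ d`!.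
Proof.
move=> suma.
(* A negative entry of [a] makes both sides vanish. *)
have [/forallP a0 | /forallPn[i]] := boolP [forall i, 0 <= a i]; last first.
  rewrite -ltNge => ai; rewrite big1 => [|g _]; last by rewrite (tabloid_fix_neg _ ai) scale0r.
  by rewrite (bigD1 i) //=; case: (a i) ai => //= n _; rewrite mul0r mul0rn.
pose b i := `|a i|%N.
have ab i : a i = (b i)%:Z by rewrite /b gez0_abs.
have sumb : (\sum_i b i = d)%N.
  apply/eqP; rewrite -eqz_nat -suma (raddf_sum Posz) //=.
  by apply/eqP/eq_bigr => i _; rewrite ab.
have b_lt i : (b i < d.+1)%N.
  by rewrite ltnS -[X in (_ <= X)%N]sumb (bigD1 i) //= leq_addr.
(* The row sums of [A] count the first colors and are prescribed by [b]; its column sums count the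
   second colors and are the exponents of the monomial. *)
pose W (A : {ffun 'I_d * 'I_d -> 'I_d.+1}) : mp :=
  if [forall i, (\sum_j A (i, j))%N == b i]
  then \prod_i \prod_j 'X_j ^+ A (i, j) else 0.
transitivity (\sum_(g : {perm 'I_d})
               \sum_(F : {ffun 'I_d -> 'I_d * 'I_d} | [forall x, F (g x) == F x])
                W (multiplicities F)).
  apply: eq_bigr => g _.
  pose pr (ff : {ffun 'I_d -> 'I_d} * {ffun 'I_d -> 'I_d}) : {ffun 'I_d -> 'I_d * 'I_d} :=
    [ffun x => (ff.1 x, ff.2 x)].
  pose unpr (F : {ffun 'I_d -> 'I_d * 'I_d}) : {ffun 'I_d -> 'I_d} * {ffun 'I_d -> 'I_d} :=
    ([ffun x => (F x).1], [ffun x => (F x).2]).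
  rewrite (reindex pr); last first.
    exists unpr => [[f1 f2] _ | F _].
      by rewrite /pr /unpr; congr (_, _); apply/ffunP => x; rewrite !ffunE.
    by apply/ffunP => x; rewrite !ffunE -surjective_pairing.
  have row f1 f2 i :
      (\sum_j multiplicities (pr (f1, f2)) (i, j))%N = #|[set x | f1 x == i]|.
    under eq_bigr => j _ do rewrite multiplicitiesE -sum1_card.
    rewrite (exchange_big_dep (fun x => f1 x == i)) /=; last first.
      by move=> j x _; rewrite inE ffunE xpair_eqE => /andP[].
    rewrite -sum1_card; apply: eq_big => [x|x f1x]; first by rewrite inE.
    rewrite (big_pred1 (f2 x)) // => j.
    by rewrite inE ffunE xpair_eqE f1x /= eq_sym.
  have -> : (tabloid_fix g a)%:R *: powersum g =
      \sum_(f1 in [set f : {ffun 'I_d -> 'I_d} |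
         [forall x, f (g x) == f x] && [forall i, (#|[set x | f x == i]| : int) == a i]])
        powersum g.
    by rewrite sumr_const scaler_nat.
  rewrite /powersum big_mkcond (eq_bigr (fun f1 : {ffun 'I_d -> 'I_d} =>
     \sum_(f2 : {ffun 'I_d -> 'I_d}) if [forall x, pr (f1, f2) (g x) == pr (f1, f2) x]
        then W (multiplicities (pr (f1, f2))) else 0)); last first.
    move=> f1 _; rewrite inE; case: ifP => [/andP[/forallP f1g /forallP f1a] | nf1].
      rewrite big_mkcond; apply: eq_bigr => f2 _.
      have -> : [forall x, pr (f1, f2) (g x) == pr (f1, f2) x] = [forall x, f2 (g x) == f2 x].
        by apply: eq_forallb => x; rewrite !ffunE /= xpair_eqE f1g.
      case: ifP => // f2g; rewrite /W.
      have col j : (\sum_i multiplicities (pr (f1, f2)) (i, j))%N = #|[set x | f2 x == j]|.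
        under eq_bigr => i _ do rewrite multiplicitiesE -sum1_card.
        rewrite (exchange_big_dep (fun x => f2 x == j)) /=; last first.
          by move=> i x _; rewrite inE ffunE xpair_eqE => /andP[].
        rewrite -sum1_card; apply: eq_big => [x|x f2x]; first by rewrite inE.
        rewrite (big_pred1 (f1 x)) // => i.
        by rewrite inE ffunE xpair_eqE f2x andbT eq_sym.
      rewrite ifT; last first.
        by apply/forallP => i; rewrite row -eqz_nat -ab; apply: f1a.
      rewrite exchange_big prodX_content mpolyXE_id /=; apply: eq_bigr => j _.
      by rewrite mnmE -col prodrXr.
    rewrite big1 // => f2 _; case: ifP => // /forallP fg.
    rewrite /W ifF //; apply/negbTE; apply: contraFN nf1 => /forallP rows.
    apply/andP; split; apply/forallP => x.
      by have := fg x; rewrite !ffunE xpair_eqE => /andP[].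
    by have := rows x; rewrite row -eqz_nat -ab.
  rewrite pair_big /= [RHS]big_mkcond; apply: eq_bigr => [[f1 f2]] _ //=.
rewrite sum_fixed_colorings; congr (_ *+ _).
under [RHS]eq_bigr => i _ do rewrite ab /= (hsym_sum _ (b_lt i)).
rewrite bigA_distr_big_dep /=.
pose cu (B : {ffun 'I_d -> {ffun 'I_d -> 'I_d.+1}}) : {ffun 'I_d * 'I_d -> 'I_d.+1} :=
  [ffun ij => B ij.1 ij.2].
pose uncu (A : {ffun 'I_d * 'I_d -> 'I_d.+1}) : {ffun 'I_d -> {ffun 'I_d -> 'I_d.+1}} :=
  [ffun i => [ffun j => A (i, j)]].
rewrite (reindex cu); last first.
  exists uncu => [B _ | A _].
    by apply/ffunP => i; apply/ffunP => j; rewrite !ffunE.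
  by apply/ffunP => [[i j]]; rewrite !ffunE.
rewrite big_mkcond [RHS]big_mkcond; apply: eq_bigr => B _ /=.
rewrite /W.
have rowE i : (\sum_j cu B (i, j) = \sum_j B i j)%N by apply: eq_bigr => j _; rewrite ffunE.
have -> : (B \in family (fun i : 'I_d => [pred A : {ffun 'I_d -> 'I_d.+1} |
    (\sum_j A j)%N == b i])) = [forall i, (\sum_j cu B (i, j))%N == b i].
  by apply: eq_forallb => i; rewrite rowE inE.
case: ifP => [_ | nsum]; case: ifP => // rows.
  by apply: eq_bigr => i _; apply: eq_bigr => j _; rewrite ffunE.
(* A matrix with row sums [b] has total [d], so the condition on the total is automatic. *)
case/negP: nsum; apply/eqP; rewrite -[RHS]sumb.
transitivity (\sum_i \sum_j cu B (i, j))%N.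
  by rewrite pair_big /=; apply: eq_bigr => [[i j]].
by apply: eq_bigr => i _; apply/eqP; move/forallP: rows; apply.
Qed.

(** By [sum_tabloid_fix_powersum], each [w] in the definition of [chi] yields the term of [w] in the
    Leibniz expansion of the determinant. *)
Lemma sum_chi_powersum lam : is_partition lam ->
  \sum_g (chi lam g)%:~R *: powersum g = (\det (jtmx X (shifted lam))) *+ d`!.
Proof.
move=> plam; under eq_bigr => g _ do rewrite /chi rmorph_sum scaler_suml.
rewrite exchange_big -sumrMnl; apply: eq_bigr => w _ /=.
have E : \sum_(i < d) ((lam i)%:Z - (i : nat)%:Z + (w i : nat)%:Z) = d%:Z.
  rewrite big_split /= sumrB [X in _ - X + _](reindex_inj (@perm_inj _ w)) /=.
  have /andP[_ /eqP sl] := plam.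
  by rewrite subrK -[in RHS]sl (raddf_sum Posz).
under eq_bigr => g _ do rewrite rmorphM rmorph_sign -scalerA scaler_sign -mulr_sign.
rewrite -mulr_sumr (sum_tabloid_fix_powersum E) -mulrnAr; congr (_ * (_ *+ _)).
apply: eq_bigr => i _; rewrite mxE; congr hsymz.
by rewrite /shifted /=; have := ltn_ord i; have := ltn_ord (w i); lia.
Qed.

(** Multiply [sum_chi_powersum] by $a_\delta$ and take the coefficient at $\lambda+\delta$: the left
    side becomes the sum of squares by [chi_coef], and the right side is $d!\,a_{\lambda+\delta}$ by
    Jacobi-Trudi. *)
Theorem chi_norm lam : is_partition lam -> \sum_g chi lam g * chi lam g = d`!%:Z.
Proof.
move=> plam.
have E : alternant X (@staircase d) * (\sum_g (chi lam g)%:~R *: powersum g) =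
         alternant X (shifted lam) *+ d`!.
  rewrite sum_chi_powersum // (jacobi_trudi _ (shifted lam)).
  move: (alternant _ _) (\det _) => u v.
  by rewrite mulrnAr mulrC.
have dec := strictly_decreasing_shifted plam.
have := congr1 (mcoeff (mnm_of (shifted lam))) E.
rewrite mcoeffMn alternant_coef // shifted_inj eqxx mulr_sumr raddf_sum /= => {}E.
apply: (@intr_inj rat); rewrite rmorph_sum /=.
transitivity (1 *+ d`! : rat) => //; rewrite -E.
by apply: eq_bigr => g _; rewrite -scalerAr mcoeffZ chi_coef rmorphM.
Qed.

End Powersum.

(** * Irreducibility and class sums *)

Section TabloidCharacter.
Variables (d : nat) (a : 'I_d -> int).
Local Notation G := [set: {perm 'I_d}]%G.
Implicit Types (f : {ffun 'I_d -> 'I_d}) (s : {perm 'I_d}).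

Definition tabloids : {set {ffun 'I_d -> 'I_d}} :=
  [set f : {ffun 'I_d -> 'I_d} | [forall i, (#|[set x | f x == i]| : int) == a i]].

(** The inverse makes this a right action, since [s * u] applies [s] first. *)
Definition tabloid_act f s : {ffun 'I_d -> 'I_d} := [ffun x => f ((s^-1)%g x)].

Lemma tabloid_act_mem f s : f \in tabloids -> tabloid_act f s \in tabloids.
Proof.
rewrite !inE => /forallP fa; apply/forallP => i; rewrite -(eqP (fa i)) eqz_nat.
rewrite -[X in _ == X](card_imset _ (@perm_inj _ s)); apply/eqP/eq_card => x.
rewrite inE ffunE; apply/eqP/imsetP => [fx | [y]]; last by rewrite inE => /eqP <- ->; rewrite permK.
by exists ((s^-1)%g x); rewrite ?permKV // inE fx.
Qed.

Definition tabloid_mx s : 'M[algC]_#|tabloids| :=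
  \matrix_(i, j) (enum_val j == tabloid_act (enum_val i) s)%:R.

Lemma tabloid_mx_repr : mx_repr G tabloid_mx.
Proof.
split=> [|s u _ _]; apply/matrixP => i j; rewrite !mxE.
  have -> : tabloid_act (enum_val i) 1 = enum_val i.
    by apply/ffunP => x; rewrite ffunE invg1 perm1.
  by rewrite (inj_eq enum_val_inj) eq_sym.
have us_mem := tabloid_act_mem s (enum_valP i).
rewrite (bigD1 (enum_rank_in us_mem (tabloid_act (enum_val i) s))) //= big1 => [|k nk].
  rewrite !mxE enum_rankK_in // eqxx mul1r addr0; congr (_ == _)%:R.
  by apply/ffunP => x; rewrite !ffunE invMg permM.
rewrite !mxE; case: eqP => [Ek|]; rewrite ?mul0r //.
by case/eqP: nk; apply: enum_val_inj; rewrite enum_rankK_in // Ek.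
Qed.

Definition tabloid_repr := MxRepresentation tabloid_mx_repr.

Lemma cfRepr_tabloid s : cfRepr tabloid_repr s = (tabloid_fix s a)%:R.
Proof.
rewrite cfunE inE mulr1n /mxtrace /tabloid_fix -[in RHS]sum1_card natr_sum.
transitivity (\sum_(f in tabloids) (f == tabloid_act f s)%:R : algC).
  rewrite [RHS]big_enum_val; apply: eq_bigr => i _; by rewrite mxE.
rewrite big_mkcond [RHS]big_mkcond; apply: eq_bigr => f _; rewrite !inE andbC.
case: ifP => //= _; have -> : (f == tabloid_act f s) = [forall x, f (s x) == f x].
  apply/eqP/forallP => [fs x | fs]; first by rewrite {1}fs ffunE permK.
  by apply/ffunP => x; rewrite ffunE -(eqP (fs ((s^-1)%g x))) permKV.
by case: ifP.
Qed.

End TabloidCharacter.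

Section IrreducibleChi.
Variable d : nat.
Local Notation G := [set: {perm 'I_d}]%G.
Implicit Types (lam : {ffun 'I_d -> 'I_d.+1}).

(** As a signed sum of permutation characters, [chi lam] is a virtual character; by [chi_norm] its
    norm is 1, so it is irreducible up to a sign. *)
Lemma chi_irr lam : is_partition lam ->
  exists b : bool, exists i : Iirr G,
    forall s, (chi lam s)%:~R = (-1) ^+ b * 'chi_i s.
Proof.
move=> plam.
pose alpha (w : {perm 'I_d}) i : int := (lam i)%:Z - (i : nat)%:Z + (w i : nat)%:Z.
pose phi : 'CF(G) := \sum_w (-1) ^+ odd_perm w *: cfRepr (tabloid_repr (alpha w)).
have phiE s : phi s = (chi lam s)%:~R.
  rewrite sum_cfunE rmorph_sum; apply: eq_bigr => w _.
  by rewrite cfunE cfRepr_tabloid rmorphM rmorph_sign.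
have Zphi : phi \in 'Z[irr G]%g.
  by apply: rpred_sum => w _; rewrite rpredZsign char_vchar ?cfRepr_char.
have Nphi : '[phi] = 1.
  rewrite cfdotE.
  have -> : \sum_(s in G) phi s * (phi s)^* = (d`!)%:R.
    transitivity ((\sum_s chi lam s * chi lam s)%:~R : algC); last by rewrite chi_norm.
    rewrite rmorph_sum; apply: eq_big => [s|s _]; first by rewrite inE.
    by rewrite phiE rmorph_int rmorphM.
  by rewrite cardsT card_Sn mulVf // pnatr_eq0 -lt0n fact_gt0.
have [b [i E]] := vchar_norm1P Zphi Nphi.
by exists b, i => s; rewrite -phiE E cfunE.
Qed.

(** A class sum commutes with the representation, so it is scalar by Schur's lemma; the trace
    determines the scalar. *)
Lemma class_sum_scalar (i : Iirr G) (C : {set {perm 'I_d}}) : C \in classes G ->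
  \sum_(s in C) 'Chi_i s = (#|C|%:R * 'chi_i (repr C) / 'chi_i 1%g)%:M.
Proof.
move=> GC; have /imsetP[x _ EC] := GC.
have chiC s : s \in C -> 'chi_i s = 'chi_i (repr C).
  have /imsetP[y _ ->] : repr C \in (x ^: G)%g.
    by rewrite -EC; apply: (mem_repr x); rewrite EC class_refl.
  by rewrite EC => /imsetP[z _ ->]; rewrite !cfunJ ?inE.
have /is_scalar_mxP[c Ec] : is_scalar_mx (\sum_(s in C) 'Chi_i s).
  apply: (mx_abs_irr_cent_scalar (groupC (socle_irr _))).
  apply/centgmxP => g _; rewrite mulmx_suml mulmx_sumr.
  rewrite [RHS](reindex_inj (conjg_inj g)) /=; apply: eq_big => s.
    by rewrite EC memJ_norm // (subsetP (class_norm _ _)) // inE.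
  by move=> _; rewrite -!repr_mxM ?inE // conjgE !mulgA mulgV mul1g.
rewrite Ec; congr (_%:M).
have := congr1 mxtrace Ec; rewrite raddf_sum mxtrace_scalar /=.
have trE s : \tr ('Chi_i s) = 'chi_i s by rewrite -irrRepr cfunE inE mulr1n.
under eq_bigr => s Cs do rewrite trE (chiC s Cs).
rewrite sumr_const => E.
have -> : #|C|%:R * 'chi_i (repr C) = c * 'chi_i 1%g.
  by rewrite mulr_natl E irr1_degree mulr_natr.
by rewrite mulfK ?irr1_neq0.
Qed.

Lemma sum_irr_compprod (i : Iirr G) t (C : 'I_t -> {set {perm 'I_d}}) :
  (forall k, C k \in classes G) ->
  \sum_(sg : {ffun 'I_t -> {perm 'I_d}} | [forall k, sg k \in C k]) 'chi_i (compprod sg) =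
  'chi_i 1%g * \prod_k (#|C k|%:R * 'chi_i (repr (C k)) / 'chi_i 1%g).
Proof.
move=> GC.
have trE s : \tr ('Chi_i s) = 'chi_i s by rewrite -irrRepr cfunE inE mulr1n.
have reprP (r : 'I_t -> {perm 'I_d}) : 'Chi_i (\prod_k r k)%g = \prod_k 'Chi_i (r k).
  apply: (big_morph 'Chi_i) => [x y|]; last by rewrite repr_mx1.
  by rewrite repr_mxM ?inE.
(* [compprod] multiplies in reversed order, so the tuples are reversed before the product of class
   sums is expanded; the resulting product of scalars is insensitive to the order. *)
pose rv (sg : {ffun 'I_t -> {perm 'I_d}}) : {ffun 'I_t -> {perm 'I_d}} :=
  [ffun k => sg (rev_ord k)].
have rvK : involutive rv by move=> sg; apply/ffunP => k; rewrite !ffunE rev_ordK.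
transitivity (\tr (\prod_k \sum_(s in C (rev_ord k)) 'Chi_i s)).
  rewrite bigA_distr_big_dep raddf_sum /= (reindex_inj (inv_inj rvK)) /=.
  apply: eq_big => [sg|sg _].
    apply/forallP/familyP => H k; last by rewrite ffunE -{2}(rev_ordK k); apply: H.
    by have := H (rev_ord k); rewrite ffunE rev_ordK.
  rewrite -reprP trE /compprod; congr ('chi_i _); apply: eq_bigr => k _.
  by rewrite ffunE rev_ordK.
rewrite (eq_bigr (fun k =>
  (#|C (rev_ord k)|%:R * 'chi_i (repr (C (rev_ord k))) / 'chi_i 1%g)%:M)); last first.
  by move=> k _; rewrite class_sum_scalar.
rewrite -(big_morph _ (@scalar_mxM _ _) (erefl _)) mxtrace_scalar.
by rewrite -mulr_natr -irr1_degree mulrC [in RHS](reindex_inj rev_ord_inj).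
Qed.

Lemma dimp_neq0 lam : is_partition lam -> dimp lam != 0.
Proof.
move=> /chi_irr[b [i E]]; rewrite /dimp -(intr_eq0 algC) E.
by rewrite mulf_eq0 signr_eq0 (negPf (irr1_neq0 i)).
Qed.

Theorem sum_chi_compprod lam t (C : 'I_t -> {set {perm 'I_d}}) :
  is_partition lam -> (0 < t)%N -> (forall k, C k \in classes G) ->
  \sum_(sg : {ffun 'I_t -> {perm 'I_d}} | [forall k, sg k \in C k])
     (chi lam (compprod sg))%:~R =
  (\prod_k #|C k|%:R) * ((dimp lam)%:~R ^- t.-1 * \prod_k (chiC lam (C k))%:~R) :> rat.
Proof.
move=> plam t0 GC; have nz := dimp_neq0 plam.
(* With denominators cleared this is an identity between integers, so it can be proved in [algC] and
   carried over to [rat]. *)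
suff E : \sum_(sg : {ffun 'I_t -> {perm 'I_d}} | [forall k, sg k \in C k])
           chi lam (compprod sg) * dimp lam ^+ t.-1 =
         (\prod_k #|C k|%:Z) * \prod_k chiC lam (C k).
  move/(congr1 (fun z : int => z%:~R : rat)): E.
  rewrite -mulr_suml !rmorphM rmorphXn [X in X * _]rmorph_sum !rmorph_prod /= => E.
  have nz' : (dimp lam)%:~R ^+ t.-1 != 0 :> rat by rewrite expf_neq0 ?intr_eq0.
  apply: (mulIf nz'); rewrite {}E; move: ((dimp lam)%:~R ^+ t.-1) nz' => D nzD.
  by field.
apply: (@intr_inj algC); have [b [i Ei]] := chi_irr plam.
rewrite -mulr_suml !rmorphM rmorphXn [X in X * _]rmorph_sum !rmorph_prod /=.
(* The sign [(-1) ^+ b] occurs to the power [t] on both sides, so it cancels. *)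
under eq_bigr => sg _ do rewrite Ei.
rewrite -mulr_sumr sum_irr_compprod // /dimp Ei /chiC.
under [in RHS]eq_bigr => k _ do rewrite -[_%:~R]/(_%:R).
under [X in _ = _ * X]eq_bigr => k _ do rewrite Ei.
rewrite !big_split /= !prodr_const card_ord exprMn.
have nz1 := irr1_neq0 i.
case: t t0 C GC => //= t _ C GC; rewrite exprS exprVn exprS.
have nzt : 'chi_i 1%g ^+ t != 0 by rewrite expf_neq0.
move: ('chi_i 1%g) ((-1) ^+ b) nz1 nzt (\prod_k _) (\prod_k _) => u v nz1 nzt p q.
by field; rewrite ?nz1 ?nzt.
Qed.

End IrreducibleChi.

(** * The hook-content formula *)

Section Hooks.
Variables (d : nat) (lam : {ffun 'I_d -> 'I_d.+1}).
Hypothesis lam_dec : forall i j : 'I_d, (i <= j)%N -> (lam j <= lam i)%N.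

(** Because [lam] decreases, the rows longer than [j] are the first [conjpart lam j] ones. *)
Lemma ltn_conjpart (k : 'I_d) j : (k < conjpart lam j)%N = (j < lam k)%N.
Proof.
rewrite /conjpart; case: (ltnP j (lam k)) => [jk | kj].
  rewrite -[X in (X < _)%N]/(k : nat) -(card_ord_lt (ltn_ord k)); apply: subset_leq_card.
  apply/subsetP => k'; rewrite !inE ltnS => /lam_dec; exact: leq_trans.
apply/negbTE; rewrite -leqNgt -[X in (_ <= X)%N](card_ord_lt (ltnW (ltn_ord k))).
apply: subset_leq_card; apply/subsetP => k'; rewrite !inE => jk'.
by rewrite ltnNge; apply/negP => /lam_dec; lia.
Qed.

Lemma conjpart_dec j j' : (j <= j')%N -> (conjpart lam j' <= conjpart lam j)%N.
Proof.
move=> jj; apply: subset_leq_card; apply/subsetP => k; rewrite !inE.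
exact: leq_ltn_trans.
Qed.

(* The hook lengths of row [i] and the differences [shifted i - shifted k] for
   [k > i] together are exactly [1, ..., shifted i]. *)
Lemma row_hooks (i : 'I_d) :
  ((\prod_(j < d | (j < lam i)%N) hook lam i j) *
   \prod_(k < d | (i < k)%N) (shifted lam i - shifted lam k) = (shifted lam i)`!)%N.
Proof.
have lam_d : (lam i <= d)%N by rewrite -ltnS.
rewrite -(big_ord_widen d (fun j => hook lam i j)) //.
rewrite -(big_mkord predT (fun j => hook lam i j)) fact_prod.
pose S1 := [seq hook lam i j | j <- iota 0 (lam i)].
pose S2 := [seq (shifted lam i - shifted lam k)%N | k <- enum [pred k : 'I_d | (i < k)%N]].
have -> : (\prod_(0 <= j < lam i) hook lam i j = \prod_(x <- S1) x)%N.
  by rewrite big_map /index_iota subn0.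
have -> : (\prod_(k < d | (i < k)%N) (shifted lam i - shifted lam k) = \prod_(x <- S2) x)%N.
  by rewrite big_map big_enum.
rewrite -big_cat; apply: perm_big; rewrite /index_iota subSS subn0.
have hookE j : (j < lam i)%N ->
    (hook lam i j + j + i + 1 = lam i + conjpart lam j)%N /\ (i < conjpart lam j)%N.
  by move=> ji; have := ltn_conjpart i j; rewrite ji /hook => H; lia.
(* The two lists together have no repetition, lie in $[1,\ell]$ with $\ell$ = [shifted lam i], and
   have $\ell$ members, so they enumerate this interval. *)
have uniq12 : uniq (S1 ++ S2).
  rewrite cat_uniq; apply/and3P; split.
  - rewrite map_inj_in_uniq ?iota_uniq // => j j'; rewrite !mem_iota !add0n /= => ji j'i E.
    have [E1 _] := hookE _ ji; have [E2 _] := hookE _ j'i.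
    by have := @conjpart_dec j j'; have := @conjpart_dec j' j; lia.
  (* Over the integers, a common value would mean [conjpart lam j - j - 1 = k - lam k]; the left
     side is larger if [j < lam k] and smaller otherwise. *)
  - apply/hasPn => x /mapP[k]; rewrite mem_enum inE => ik -> {x}.
    apply/mapP => -[j]; rewrite mem_iota add0n /= => ji E.
    have [E1 E2] := hookE _ ji; have := ltn_conjpart k j.
    have := lam_dec (ltnW ik); have := ltn_ord k; move: E; rewrite /shifted /=.
    by case: (ltnP j (lam k)); lia.
  - rewrite map_inj_in_uniq ?enum_uniq // => k k'; rewrite !mem_enum !inE => ik ik'.
    rewrite /shifted /= => E; apply: val_inj.
    have := @lam_dec k k'; have := @lam_dec k' k.
    have := lam_dec (ltnW ik); have := lam_dec (ltnW ik').
    by have := ltn_ord k; have := ltn_ord k'; move: E; rewrite /=; lia.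
have sub12 : {subset S1 ++ S2 <= iota 1 (shifted lam i)}.
  move=> x; rewrite mem_cat mem_iota => /orP[/mapP[j] | /mapP[k]].
    rewrite mem_iota add0n /= => ji ->; have [E1 E2] := hookE _ ji.
    have : (conjpart lam j <= d)%N by rewrite -[X in (_ <= X)%N](card_ord d) max_card.
    by rewrite /shifted /=; have := ltn_ord i; lia.
  rewrite mem_enum inE => ik ->; rewrite /shifted /=.
  by have := lam_dec (ltnW ik); have := ltn_ord k; lia.
have size12 : size (iota 1 (shifted lam i)) = size (S1 ++ S2).
  rewrite size_cat !size_map !size_iota -cardE /shifted; congr addn.
  have := cardC [set k : 'I_d | (k < i.+1)%N]; rewrite card_ord card_ord_lt //.
  have -> : #|[predC [set k : 'I_d | (k < i.+1)%N]]| = #|[pred k : 'I_d | (i < k)%N]|.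
    by apply: eq_card => k; rewrite !inE -leqNgt.
  by move/(canRL (addKn _)) => E; apply: esym E.
apply: uniq_perm => //; first exact: iota_uniq.
by have [_] := uniq_min_size uniq12 sub12 (eq_leq size12).
Qed.

End Hooks.

Lemma natr_rev_ord (R : pzRingType) d (i : 'I_d) :
  (rev_ord i)%:R = d.-1%:R - i%:R :> R.
Proof.
have ltid := ltn_ord i.
rewrite -natrB; last by rewrite -ltnS (ltn_predK ltid).
by congr (_%:R); rewrite /=; lia.
Qed.

(** * Contents from the Jacobi-Trudi determinant *)

Section HookContent.
Variable d : nat.
Implicit Type lam : {ffun 'I_d -> 'I_d.+1}.
Local Notation QX := {poly rat}.

(** The numerator of [mfrak] as a polynomial in $r$. *)
Definition cpoly lam : QX :=
  \prod_(i < d) \prod_(j < d | (j < lam i)%N) ('X + (j%:R - i%:R)%:P).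

(* Up to a factor depending only on the row, the Jacobi-Trudi entries at [1^r] are
   the values at [shifted lam i] of these polynomials, which do not depend on
   [lam]; the indeterminate of the coefficient ring [QX] stands for [r]. *)
Definition lagpoly (k : 'I_d) : {poly QX} :=
  (\prod_(m < rev_ord k) ('X - (m%:R)%:P)) *
  (\prod_(v < k) ('X + ('X + (v%:R - d.-1%:R)%:P)%:P)).

(** The product $(X-i)\cdots(X-1)$ extends a rising factorial of $X$ down to the content $-i$ of the
    first cell of row [i]. *)
Definition dpoly (i : nat) : QX := \prod_(u < i) ('X + (u%:R - i%:R)%:P).

Lemma dpoly_neq0 i : dpoly i != 0.
Proof.
apply/prodf_neq0 => u _; rewrite -size_poly_eq0 size_XaddC //.
Qed.

Lemma size_lagpoly k : (size (lagpoly k) <= d)%N.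
Proof.
rewrite /lagpoly; apply: leq_trans (size_polyMleq _ _) _.
have -> : \prod_(v < k) ('X + ('X + (v%:R - d.-1%:R)%:P)%:P) =
          \prod_(v < k) ('X - (- ('X + (v%:R - d.-1%:R)%:P))%:P) :> {poly QX}.
  by apply: eq_bigr => v _; rewrite polyCN opprK.
rewrite !size_prod_XsubC /index_enum -!enumT !size_enum_ord.
by have := ltn_ord k; rewrite /=; lia.
Qed.

Lemma horner_lagpoly k (l : nat) :
  (lagpoly k).[l%:R] = (\prod_(m < rev_ord k) (l%:R - m%:R)) *
     \prod_(v < k) ('X + (l%:R + v%:R - d.-1%:R)%:P).
Proof.
rewrite /lagpoly hornerM !horner_prod; congr (_ * _); apply: eq_bigr => m _.
  by rewrite !hornerE.
by rewrite hornerD hornerX hornerC addrCA -[in RHS]addrA [in RHS]polyCD polyC_natr.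
Qed.

Lemma prod_ffact (l m : nat) : (m <= l)%N ->
  (\prod_(u < m) (l%:R - u%:R)) * (l - m)`!%:R = l`!%:R :> QX.
Proof.
elim: m => [|m IH] ml; first by rewrite big_ord0 mul1r subn0.
rewrite big_ord_recr /= -IH ?(ltnW ml) // -mulrA; congr (_ * _).
by rewrite -natrB ?(ltnW ml) // -natrM -[(l - m)%N]prednK ?subn_gt0 // factS subnS.
Qed.

(** Let $n=\ell-(d-1-k)$. Multiplying $X(X+1)\cdots(X+n-1)$ by [dpoly i] gives $i+n=\lambda_i+k$
    consecutive factors: the first $\lambda_i$ are those of row [i], the others and $\ell!/n!$ make
    up [lagpoly k]. If $n<0$, [lagpoly k] vanishes at $\ell$. *)
Lemma jt_entry lam (i k : 'I_d) :
  risingz ((shifted lam i)%:Z - (rev_ord k : nat)%:Z) * ((shifted lam i)`!%:R * dpoly i) =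
  (\prod_(j < d | (j < lam i)%N) ('X + (j%:R - i%:R)%:P)) * (lagpoly k).[(shifted lam i)%:R].
Proof.
set l := shifted lam i; rewrite horner_lagpoly.
case: (leqP (rev_ord k) l) => [kl | lk]; last first.
  have -> : l%:Z - (rev_ord k : nat)%:Z = Negz (rev_ord k - l).-1 by lia.
  by rewrite mul0r [X in _ * (X * _)](bigD1 (Ordinal lk)) //= subrr !mul0r mulr0.
rewrite subzn // [risingz _]/(rising _) /rising -mul_polyC.
rewrite -(prod_ffact kl).
set P := \prod_(m < rev_ord k) _.
have nz : (l - rev_ord k)`!%:R != 0 :> rat by rewrite pnatr_eq0 -lt0n fact_gt0.
have E1 : ((l - rev_ord k)`!%:R^-1)%:P * (l - rev_ord k)`!%:R = 1 :> QX.
  by rewrite -polyC_natr -polyCM mulVf.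
pose F u : QX := 'X + (u%:R - i%:R)%:P.
have EL : (\prod_(u < l - rev_ord k) ('X + u%:R%:P)) * dpoly i =
          \prod_(u < i + (l - rev_ord k)) F u.
  rewrite big_split_ord /= mulrC; congr (_ * _); apply: eq_bigr => u _.
  by rewrite /F natrD addrAC subrr add0r.
have ER : (\prod_(j < d | (j < lam i)%N) F j) *
          \prod_(v < k) ('X + (l%:R + v%:R - d.-1%:R)%:P) =
          \prod_(u < i + (l - rev_ord k)) F u.
  rewrite -(big_ord_widen d F); last by rewrite -ltnS.
  have -> : (i + (l - rev_ord k) = lam i + k)%N.
    by move: kl; rewrite /l /shifted /=; have := ltn_ord i; have := ltn_ord k; lia.
  rewrite big_split_ord /=; congr (_ * _); apply: eq_bigr => v _.
  by rewrite /F /l /shifted natrD natr_rev_ord natrD; congr (_ + _%:P); ring.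
transitivity (P * ((((l - rev_ord k)`!%:R^-1)%:P * (l - rev_ord k)`!%:R) *
   ((\prod_(u < l - rev_ord k) ('X + u%:R%:P)) * dpoly i))); first by ring.
rewrite E1 EL mul1r -ER /F; ring.
Qed.

Lemma det_scale_rows (R : comNzRingType) n (r : 'I_n -> R) (M : 'M[R]_n) :
  \det (\matrix_(i, j) (r i * M i j)) = (\prod_i r i) * \det M.
Proof.
have -> : \matrix_(i, j) (r i * M i j) = diag_mx (\row_i r i) *m M.
  by apply/matrixP => i j; rewrite mul_diag_mx !mxE.
by rewrite det_mulmx det_diag; congr (_ * _); apply: eq_bigr => i _; rewrite mxE.
Qed.

Definition diffprod (a : 'I_d -> nat) : QX :=
  \prod_(i < d) \prod_(j < d | (i < j)%N) ((a j)%:R - (a i)%:R).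

Lemma det_lagpoly (a : 'I_d -> nat) :
  \det (\matrix_(i, k) (lagpoly k).[(a i)%:R]) =
  diffprod a * \det (\matrix_(e, k) (lagpoly k)`_e : 'M[QX]_d).
Proof.
have -> : \matrix_(i, k) (lagpoly k).[(a i)%:R] =
  (Vandermonde d (\row_i (a i)%:R))^T *m \matrix_(e, k) (lagpoly k)`_e :> 'M[QX]_d.
  apply/matrixP => i k; rewrite !mxE (horner_coef_wide _ (size_lagpoly k)).
  by apply: eq_bigr => e _; rewrite !mxE mulrC.
rewrite det_mulmx det_tr det_Vandermonde; congr (_ * _).
by apply: eq_bigr => i _; apply: eq_bigr => j _; rewrite !mxE.
Qed.

(** The matrix is triangular, because [lagpoly k] vanishes at the naturals below [rev_ord k]. This
    serves to compute the determinant of coefficients in [det_lagpoly]. *)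
Lemma det_lagpoly_staircase :
  \det (\matrix_(i, k) (lagpoly k).[(@staircase d i)%:R]) =
  \prod_(k < d) ((rev_ord k)`!%:R * dpoly k).
Proof.
rewrite -det_tr det_trig; last first.
  apply/is_trig_mxP => i j ij; rewrite !mxE horner_lagpoly.
  have lt : (staircase j < rev_ord i)%N by rewrite /staircase /=; have := ltn_ord j; lia.
  by rewrite (bigD1 (Ordinal lt)) //= subrr !mul0r.
apply: eq_bigr => k _; rewrite !mxE horner_lagpoly; congr (_ * _).
  by rewrite -(prod_ffact (leqnn _)) subnn mulr1.
apply: eq_bigr => v _; congr ('X + _%:P).
by rewrite /staircase natr_rev_ord; ring.
Qed.

(** The product of [row_hooks] over all rows; the signs adjust to the Vandermonde orientation of
    [diffprod]. *)
Lemma fact_row_hooks lam :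
  (forall i j : 'I_d, (i <= j)%N -> (lam j <= lam i)%N) ->
  \prod_i (shifted lam i)`!%:R =
  (\prod_(i < d) \prod_(j < d | (j < lam i)%N) (hook lam i j)%:R) *
  ((\prod_(i < d) \prod_(j < d | (i < j)%N) -1) * diffprod (shifted lam)) :> QX.
Proof.
move=> dec; rewrite -!big_split /=; apply: eq_bigr => i _.
rewrite -(row_hooks dec) natrM !natr_prod; congr (_ * _).
rewrite -big_split /=; apply: eq_bigr => k ik; rewrite mulN1r opprB natrB //.
by rewrite /shifted /=; have := dec _ _ (ltnW ik); have := ltn_ord k; lia.
Qed.

(** Scaling rows by [jt_entry] turns [jtpoly lam] into [cpoly lam] times a Vandermonde product and a
    factor [QD] independent of [lam]. The staircase determines [QD], and [fact_row_hooks] converts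
    the factorials into hook lengths. *)
Lemma hook_content_poly lam : is_partition lam ->
  jtpoly lam * \prod_(i < d) \prod_(j < d | (j < lam i)%N) (hook lam i j)%:R = cpoly lam.
Proof.
move=> /partition_dec dec.
pose QD := \det (\matrix_(e, k) (lagpoly k)`_e : 'M[QX]_d).
pose eps : QX := \prod_(i < d) \prod_(j < d | (i < j)%N) -1.
pose H : QX := \prod_(i < d) \prod_(j < d | (j < lam i)%N) (hook lam i j)%:R.
pose D : QX := \prod_(i < d) dpoly i.
have Dnz : D != 0 by apply/prodf_neq0 => i _; apply: dpoly_neq0.
have E1 : jtpoly lam * ((\prod_i (shifted lam i)`!%:R) * D) =
          cpoly lam * (diffprod (shifted lam) * QD).
  rewrite -big_split mulrC /jtpoly -det_scale_rows -det_lagpoly -det_scale_rows.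
  congr (\det _); apply/matrixP => i k; rewrite !mxE mulrC; exact: jt_entry.
have E2 : diffprod (@staircase d) * QD = (\prod_(k < d) (rev_ord k)`!%:R) * D.
  by rewrite -det_lagpoly det_lagpoly_staircase big_split.
have E3 := fact_row_hooks dec; rewrite -/eps -/H in E3.
(* This is [fact_row_hooks] for the empty diagram, which has no hooks. *)
have E4 : \prod_(k < d) (rev_ord k)`!%:R = eps * diffprod (@staircase d).
  pose lam0 : {ffun 'I_d -> 'I_d.+1} := [ffun=> ord0].
  have dec0' (i j : 'I_d) : (i <= j)%N -> (lam0 j <= lam0 i)%N by rewrite !ffunE.
  have E := fact_row_hooks dec0'; rewrite -/eps in E.
  have sE i : shifted lam0 i = @staircase d i by rewrite /shifted ffunE.
  transitivity (\prod_i (shifted lam0 i)`!%:R : QX).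
    by apply: eq_bigr => i _; rewrite sE.
  rewrite E big1 => [|i _]; last by rewrite big1 // => j; rewrite ffunE.
  rewrite mul1r; congr (_ * _); apply: eq_bigr => i _; apply: eq_bigr => j _.
  by rewrite !sE.
have f0 n : (n`!)%:R != 0 :> QX by rewrite -polyC_natr polyC_eq0 pnatr_eq0 -lt0n fact_gt0.
have nz_dl : diffprod (shifted lam) != 0.
  have : \prod_i (shifted lam i)`!%:R != 0 :> QX by apply/prodf_neq0.
  by rewrite E3 !mulf_eq0 !negb_or => /and3P[].
have nz_ds : diffprod (@staircase d) != 0.
  have : \prod_(k < d) (rev_ord k)`!%:R != 0 :> QX by apply/prodf_neq0.
  by rewrite E4 !mulf_eq0 !negb_or => /andP[].
have nz_eps : eps != 0.
  have : \prod_(k < d) (rev_ord k)`!%:R != 0 :> QX by apply/prodf_neq0.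
  by rewrite E4 !mulf_eq0 !negb_or => /andP[].
have EQ : QD = eps * D.
  by apply: (mulfI nz_ds); rewrite E2 E4; ring.
apply: (mulIf (mulf_neq0 (mulf_neq0 nz_dl nz_eps) Dnz)); rewrite -/H.
transitivity (jtpoly lam * ((H * (eps * diffprod (shifted lam))) * D)); first by ring.
by rewrite -E3 E1 EQ; ring.
Qed.

Definition hookprod lam : rat :=
  \prod_(i < d) \prod_(j < d | (j < lam i)%N) (hook lam i j)%:R.

Lemma hook_neq0 lam (i : 'I_d) (j : nat) : is_partition lam ->
  (j < lam i)%N -> hook lam i j != 0%N.
Proof.
move=> /partition_dec dec ji.
by have := ltn_conjpart dec i j; rewrite ji /hook => H; lia.
Qed.

Lemma hookprod_neq0 lam : is_partition lam -> hookprod lam != 0.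
Proof.
move=> plam; apply/prodf_neq0 => i _; apply/prodf_neq0 => j ji.
by rewrite pnatr_eq0 hook_neq0.
Qed.

Lemma jtpoly_cpoly lam : is_partition lam -> hookprod lam *: jtpoly lam = cpoly lam.
Proof.
move=> plam; rewrite -hook_content_poly // -mul_polyC mulrC; congr (_ * _).
rewrite rmorph_prod; apply: eq_bigr => i _; rewrite rmorph_prod; apply: eq_bigr => j _.
by rewrite /= polyC_natr.
Qed.

Theorem hook_content lam (r : nat) : is_partition lam ->
  mfrak lam r%:Z = (jtpoly lam).[r%:R].
Proof.
move=> plam; apply: (mulfI (hookprod_neq0 plam)).
rewrite -hornerZ jtpoly_cpoly // /hookprod /mfrak -big_split /=.
rewrite /cpoly horner_prod; apply: eq_bigr => i _.
rewrite horner_prod -big_split /=; apply: eq_bigr => j ji.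
by rewrite hornerD hornerX hornerC mulrCA divff ?mulr1 // pnatr_eq0 hook_neq0.
Qed.

(** The degree of [cpoly lam] is the number of cells, which is [d]. *)
Lemma size_jtpoly lam : is_partition lam -> (size (jtpoly lam) <= d.+1)%N.
Proof.
move=> plam; rewrite -(size_scale _ (hookprod_neq0 plam)) jtpoly_cpoly //.
rewrite /cpoly; have /andP[_ /eqP sl] := plam; rewrite -[X in (_ <= X.+1)%N]sl.
rewrite size_prod => [|i _]; last first.
  by apply/prodf_neq0 => j _; rewrite -size_poly_eq0 size_XaddC.
rewrite leq_subLR card_ord.
have row i : size (\prod_(j < d | (j < lam i)%N) ('X + (j%:R - i%:R)%:P) : QX) = (lam i).+1.
  rewrite -(big_ord_widen d (fun j => 'X + (j%:R - i%:R)%:P : QX)); last by rewrite -ltnS.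
  rewrite (eq_bigr (fun j : 'I_(lam i) => 'X - (- (j%:R - i%:R))%:P)); last first.
    by move=> j _; rewrite polyCN opprK.
  by rewrite size_prod_XsubC /index_enum -enumT size_enum_ord.
under eq_bigr => i _ do rewrite row -addn1.
by rewrite big_split /= sum1_card card_ord addnC addnS.
Qed.

End HookContent.

(** * Stirling numbers and Newton interpolation *)

Lemma eq_poly_at N (x : nat -> rat) (p q : {poly rat}) : injective x ->
  (size p <= N)%N -> (size q <= N)%N ->
  (forall n, (n < N)%N -> p.[x n] = q.[x n]) -> p = q.
Proof.
move=> inj_x sp sq pq; apply/eqP; rewrite -subr_eq0; apply/eqP.
apply: (@roots_geq_poly_eq0 _ _ (mkseq x N)).
- apply/allP => y /mapP[n]; rewrite mem_iota add0n /= => nN -> {y}.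
  by rewrite rootE hornerD hornerN pq ?subrr.
- by rewrite mkseq_uniq.
- by rewrite size_mkseq (leq_trans (size_polyD _ _)) // size_polyN geq_max sp.
Qed.

Lemma ncycles_le (T : finType) (s : {perm T}) : (ncycles s <= #|T|)%N.
Proof. exact: leq_imset_card. Qed.

(** Counting pairs of a permutation and a coloring that it fixes gives, by [sum_fixed_colorings],
    $a!$ times $h_a$ at [r.+1] ones. The successor supplies the default color of
    [card_fixed_colorings]. *)
Lemma sum_expn_ncycles a r :
  \sum_(s : {perm 'I_a}) r.+1%:R ^+ ncycles s = \prod_(k < a) (r.+1%:R + k%:R) :> rat.
Proof.
transitivity (\sum_(s : {perm 'I_a})
   \sum_(F : {ffun 'I_a -> 'I_r.+1} | [forall x, F (s x) == F x]) (1 : rat)).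
  apply: eq_bigr => s _; rewrite -natrX -{1}(card_ord r.+1) -cardsT.
  rewrite -(card_fixed_colorings s _ ord0) sumr_const; congr (_%:R).
  apply: eq_card => f; rewrite inE [LHS]andb_idr // => _.
  by apply/forallP => x; rewrite inE.
rewrite (sum_fixed_colorings (fun=> 1)).
have <- : hsym (fun i : 'I_r.+1 => (i < r.+1)%N%:R : rat) a =
   \sum_(A : {ffun 'I_r.+1 -> 'I_a.+1} | (\sum_u A u)%N == a) 1.
  rewrite (hsym_sum _ (ltnSn a)); apply: eq_bigr => A _.
  by rewrite big1 // => i _; rewrite ltn_ord expr1n.
by rewrite hsym_ones // horner_rising -[LHS]mulr_natr divfK // pnatr_eq0 -lt0n fact_gt0.
Qed.

Definition falling a : {poly rat} := \prod_(k < a) ('X - k%:R%:P).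

Lemma size_falling a : size (falling a) = a.+1.
Proof. by rewrite size_prod_XsubC /index_enum -enumT size_enum_ord. Qed.

(* Compared at the points [- (r + 1)], where the signs cancel. *)
Lemma falling_ncycles a :
  falling a = \sum_(s : {perm 'I_a}) (-1) ^+ (a + ncycles s) *: 'X^(ncycles s).
Proof.
apply: (@eq_poly_at a.+1 (fun n => - n.+1%:R)).
- by move=> n n' /oppr_inj/eqP; rewrite eqr_nat => /eqP[].
- by rewrite size_falling.
- apply: (leq_trans (size_sum _ _ _)); apply/bigmax_leqP => s _.
  rewrite (leq_trans (size_scale_leq _ _)) // size_polyXn ltnS.
  by rewrite -[X in (_ <= X)%N]card_ord ncycles_le.
move=> r _; rewrite horner_prod.
transitivity ((-1) ^+ a * \prod_(k < a) (r.+1%:R + k%:R) : rat).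
  rewrite -[in X in X * _](card_ord a) -prodrN; apply: eq_bigr => k _.
  by rewrite !hornerE; ring.
rewrite -sum_expn_ncycles mulr_sumr horner_sum; apply: eq_bigr => s _.
rewrite hornerZ hornerXn exprD -mulrA; congr (_ * _).
by rewrite -exprMn mulrNN mul1r.
Qed.

Lemma coef_falling a b : (falling a)`_b = (-1) ^+ (a + b) * (stirling1 a b)%:R.
Proof.
rewrite falling_ncycles coef_sum /stirling1 -sum1_card natr_sum mulr_sumr.
rewrite [RHS]big_mkcond; apply: eq_bigr => s _; rewrite inE coefZ coefXn eq_sym.
by case: eqP => [->|_]; rewrite ?mulr1 ?mulr0.
Qed.

Lemma stirling1_gt a b : (a < b)%N -> stirling1 a b = 0%N.
Proof.
move=> ab; have := coef_falling a b; rewrite nth_default ?size_falling //.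
by move/esym/eqP; rewrite mulf_eq0 signr_eq0 pnatr_eq0 => /eqP.
Qed.

Lemma horner_falling a (n : nat) : (falling a).[n%:R] = (n ^_ a)%:R.
Proof.
rewrite /falling horner_prod; elim: a => [|a IH]; first by rewrite big_ord0 ffactn0.
rewrite big_ord_recr /= IH ffactnSr natrM !hornerE.
case: (leqP a n) => [an | na]; first by rewrite natrB.
by rewrite ffact_small ?mul0r.
Qed.

(** * Newton interpolation in falling factorials *)

Lemma sum_sign_bin n N : (n < N)%N ->
  \sum_(j < N) (-1) ^+ j * 'C(n, j)%:R = (n == 0%N)%:R :> rat.
Proof.
move=> nN; rewrite -[in RHS]expr0n -[X in X ^+ n](subrr 1) exprDn.
rewrite (big_ord_widen N (fun i => 1 ^+ (n - i) * (-1) ^+ i *+ 'C(n, i))) //.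
rewrite [RHS]big_mkcond; apply: eq_bigr => j _; rewrite ltnS.
case: leqP => [_ | nj]; last by rewrite bin_small ?mulr0.
by rewrite expr1n mul1r mulr_natr.
Qed.

Lemma ffactnD n m k : (n ^_ (m + k) = n ^_ m * (n - m) ^_ k)%N.
Proof.
rewrite !ffact_prod big_split_ord /=; congr muln.
by apply: eq_bigr => i _; rewrite subnDA.
Qed.

(** After multiplication by $j!$ both sides equal [r ^_ (s + j)]. *)
Lemma bin_mul_ffact r s j : ('C(r, j) * (r - j) ^_ s = r ^_ s * 'C(r - s, j))%N.
Proof.
apply/eqP; rewrite -(eqn_pmul2r (fact_gt0 j)); apply/eqP.
by rewrite mulnAC bin_ffact -mulnA bin_ffact -!ffactnD addnC.
Qed.

(** The [r]-th finite difference of [p] at 0, divided by $r!$. *)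
Definition newton r (p : {poly rat}) : rat :=
  (\sum_(j < r.+1) (-1) ^+ j * 'C(r, j)%:R * p.[(r - j)%:R]) / r`!%:R.

Lemma newton_falling r s : newton r (falling s) = (r == s)%:R.
Proof.
rewrite /newton.
under eq_bigr => j _ do
  rewrite horner_falling -mulrA -natrM bin_mul_ffact natrM mulrCA.
rewrite -mulr_sumr; case: (ltnP r s) => [rs | sr].
  by rewrite ffact_small // !mul0r ltn_eqF.
rewrite sum_sign_bin ?ltnS ?leq_subr // subn_eq0 eqn_leq sr andbT.
case: (leqP r s) => [rs|_]; last by rewrite mulr0 mul0r.
have -> : s = r by lia.
by rewrite mulr1 ffactnn divff // pnatr_eq0 -lt0n fact_gt0.
Qed.

Lemma newton_sum r (I : finType) (P : pred I) (c : I -> rat) (p : I -> {poly rat}) :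
  newton r (\sum_(i | P i) c i *: p i) = \sum_(i | P i) c i * newton r (p i).
Proof.
rewrite /newton; under [RHS]eq_bigr => i _ do rewrite mulrA mulr_sumr.
rewrite -mulr_suml exchange_big /=; congr (_ / _); apply: eq_bigr => j _.
rewrite horner_sum mulr_sumr; apply: eq_bigr => i _.
by rewrite hornerZ mulrCA.
Qed.

(** Since [falling N] is monic of degree [N], subtracting a multiple of it lowers the degree. *)
Lemma falling_span N (p : {poly rat}) : (size p <= N)%N ->
  exists c : nat -> rat, p = \sum_(r < N) c r *: falling r.
Proof.
elim: N p => [|N IH] p.
  rewrite leqn0 size_poly_eq0 => /eqP ->; exists (fun=> 0).
  by rewrite big_ord0.
move=> sp; have [c Ec] : exists c : nat -> rat,
    p - p`_N *: falling N = \sum_(r < N) c r *: falling r.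
  apply: IH; apply/leq_sizeP => j; rewrite leq_eqVlt => /orP[/eqP <- | Nj].
    rewrite coefB coefZ.
    have -> : (falling N)`_N = 1.
      have /monicP := monic_prod_XsubC (index_enum 'I_N) predT (fun k => k%:R : rat).
      by rewrite lead_coefE -[\prod_(i <- _ | _) _]/(falling N) size_falling.
    by rewrite mulr1 subrr.
  rewrite coefB coefZ [X in X - _]nth_default; last exact: leq_trans sp Nj.
  by rewrite [X in _ * X]nth_default ?size_falling // mulr0 subrr.
exists (fun r => if (r < N)%N then c r else p`_N).
rewrite big_ord_recr /= ltnn -[LHS](subrK (p`_N *: falling N)) Ec; congr (_ + _).
by apply: eq_bigr => r _; rewrite ltn_ord.
Qed.

(** [falling_span] provides coordinates, and [newton_falling] identifies them by duality. *)
Theorem newton_expansion N (p : {poly rat}) : (size p <= N)%N ->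
  p = \sum_(r < N) newton r p *: falling r.
Proof.
case/falling_span => c Ec; rewrite {1}Ec; apply: eq_bigr => r _.
congr (_ *: _); rewrite Ec newton_sum (bigD1 r) //= newton_falling eqxx mulr1.
rewrite big1 ?addr0 // => s sr; rewrite newton_falling.
by rewrite -[_ == _ :> nat]/(r == s) eq_sym (negPf sr) mulr0.
Qed.

(** In the expansion up to [m + K], which exceeds the degree of [p], the terms of index below [m]
    have no coefficient at $X^m$; the others carry the sign $(-1)^{2m+k}$. *)
Lemma coef_newton d m K (p : {poly rat}) : (size p <= d.+1)%N -> (d < K)%N ->
  p`_m = \sum_(k < K) (-1) ^+ k * (stirling1 (m + k) m)%:R * newton (m + k) p.
Proof.
move=> sp dK; have spN : (size p <= m + K)%N by lia.
rewrite {1}(newton_expansion spN) coef_sum big_split_ord /= big1 => [|r _]; last first.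
  by rewrite coefZ coef_falling stirling1_gt // !mulr0.
rewrite add0r; apply: eq_bigr => k _; rewrite coefZ coef_falling mulrC.
by rewrite addnAC addnn -signr_odd oddD odd_double signr_odd.
Qed.

(* Both sides have degree at most [d] and agree at [0, ..., d]. *)
Lemma polyXn_ncycles d (g : {perm 'I_d}) : (0 < d)%N ->
  'X^(ncycles g) = \sum_(lam | is_partition lam) (chi lam g)%:~R *: jtpoly lam.
Proof.
move=> d0; apply: (@eq_poly_at d.+1 (fun n => n%:R)) => [n n' /eqP|||r rd].
- by rewrite eqr_nat => /eqP.
- by rewrite size_polyXn ltnS -[X in (_ <= X)%N]card_ord ncycles_le.
- apply: (leq_trans (size_sum _ _ _)); apply/bigmax_leqP => lam plam.
  exact: leq_trans (size_scale_leq _ _) (size_jtpoly plam).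
rewrite hornerXn -natrX expn_ncycles_le // horner_sum.
by apply: eq_bigr => lam _; rewrite hornerZ.
Qed.

(* The series over k >= 0 has only finitely many nonzero terms; we state that
   every truncation at K > d equals xi. *)
Theorem theorem2p2 (d t : nat) (C : 'I_t -> {set {perm 'I_d}}) (m : nat)
  (hd : (1 <= d)%N) (ht : (1 <= t)%N)
  (hC : forall i, C i \in classes [set: {perm 'I_d}]) :
  forall K : nat, (d < K)%N ->
    (xi m C)%:R = \sum_(k < K) (-1) ^+ k * (stirling1 (m + k) m)%:R * Wdr (m + k) C :> rat.
Proof.
move=> K dK.
pose p : {poly rat} := \sum_(sg : {ffun 'I_t -> {perm 'I_d}} | [forall i, sg i \in C i])
                         'X^(ncycles (compprod sg)).
have <- : p`_m = (xi m C)%:R.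
  rewrite coef_sum /xi -sum1_card natr_sum [LHS]big_mkcond [RHS]big_mkcond.
  by apply: eq_bigr => sg _; rewrite inE coefXn eq_sym; case: ifP => //=; case: ifP.
have sp : (size p <= d.+1)%N.
  apply: (leq_trans (size_sum _ _ _)); apply/bigmax_leqP => sg _.
  by rewrite size_polyXn ltnS -[X in (_ <= X)%N]card_ord ncycles_le.
rewrite (coef_newton m sp dK); apply: eq_bigr => k _; congr (_ * _).
have -> : p = \sum_(lam | is_partition lam)
    (\sum_(sg : {ffun 'I_t -> {perm 'I_d}} | [forall i, sg i \in C i])
       (chi lam (compprod sg))%:~R) *: jtpoly lam.
  under [RHS]eq_bigr => lam _ do rewrite scaler_suml.
  rewrite exchange_big /=; apply: eq_bigr => sg _; exact: polyXn_ncycles.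
rewrite newton_sum /Wdr mulr_sumr; apply: eq_bigr => lam plam.
rewrite sum_chi_compprod // /newton.
(* By the hook-content formula, [newton] of [jtpoly lam] is [cfrak] divided by the factorial in
   [Wdr]. *)
have -> : \sum_(j < (m + k).+1) (-1) ^+ j * 'C(m + k, j)%:R * (jtpoly lam).[(m + k - j)%:R]
   = cfrak lam (m + k).
  by apply: eq_bigr => j _; rewrite hook_content.
by ring.
Qed.
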